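(* Let $d,n$ be positive integers. The algebra $\mathbb{C}(q){\rm Y}_{d,n}(q):=\mathbb{C}(q)\otimes_{\mathbb{C}[q,q^{-1}]}{\rm Y}_{d,n}(q)$ is split semisimple (over the field $\mathbb{C}(q)$).
   Context: Let $q$ be an indeterminate. The Yokonuma--Hecke algebra ${\rm Y}_{d,n}(q)$ is the associative unital $\mathbb{C}[q,q^{-1}]$-algebra generated by $g_1,\dots,g_{n-1},t_1,\dots,t_n$ with relations: $g_ig_j=g_jg_i$ if $|i-j|>1$; $g_ig_{i+1}g_i=g_{i+1}g_ig_{i+1}$ for $1\le i\le n-2$; $t_it_j=t_jt_i$; $t_jg_i=g_it_{s_i(j)}$ where $s_i=(i,i+1)\in\mathfrak{S}_n$; $t_j^d=1$; and $g_i^2=q+(q-1)e_ig_i$, where $e_i=\frac1d\sum_{s=0}^{d-1}t_i^st_{i+1}^{-s}$. *)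

(* Defs.v *)
From HB Require Import structures.
From mathcomp Require Import all_boot all_order perm all_algebra.
From mathcomp Require Import boolp reals complex finmap.
From mathcomp Require Import monalg.

Set Implicit Arguments.
Unset Strict Implicit.
Unset Printing Implicit Defensive.

Import GRing.Theory Num.Theory.
Local Open Scope ring_scope.
Local Open Scope quotient_scope.

Section Semisimple.
Variable B : pzRingType.

Definition simple_module (V : lmodType B) : Prop :=
  (exists v : V, v != 0) /\
  forall S : {pred V}, submod_closed S ->
    (forall v, v \in S -> v = 0) \/ (forall v, v \in S).

Definition semisimple_module (V : lmodType B) : Prop :=
  forall S : {pred V}, submod_closed S ->
    exists T : {pred V},
      [/\ submod_closed T,
          forall v, v \in S -> v \in T -> v = 0
        & forall v, exists s t, [/\ s \in S, t \in T & v = s + t]].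

Definition semisimple_ring : Prop := semisimple_module B^o.

End Semisimple.

Section SplitSemisimple.
Variables (K : fieldType) (B : algType K).

(* [End_B V = K] for every simple left [B]-module [V]; [K] acts on [V] through
   the structure map [c |-> c%:A] of the algebra. *)
Definition split_algebra : Prop :=
  forall V : lmodType B, simple_module V ->
    forall f : {linear V -> V}, exists c : K, forall v, f v = (c%:A : B) *: v.

Definition split_semisimple : Prop := semisimple_ring B /\ split_algebra.

End SplitSemisimple.

Inductive zspan (V : zmodType) (S : V -> Prop) : V -> Prop :=
| zspan0 : zspan S 0
| zspanB x y : zspan S x -> zspan S y -> zspan S (x - y)
| zspan_gen x : S x -> zspan S x.

Section Zspan.
Variables (V : zmodType) (S : V -> Prop).

Definition zspan_pred : pred V := fun x => `[< zspan S x >].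

Lemma zspan_pred_closed : zmod_closed zspan_pred.
Proof.
split=> [|x y /asboolP Sx /asboolP Sy]; apply/asboolP.
  exact: zspan0.
exact: zspanB.
Qed.

HB.instance Definition _ :=
  GRing.isZmodClosed.Build V zspan_pred zspan_pred_closed.
Definition zspan_closed : zmodClosed V := GRing.ZmodClosed.clone V zspan_pred _.

Definition zquot : Type := {ideal_quot zspan_closed}.
HB.instance Definition _ := GRing.Zmodule.on zquot.

Fact pr_key : unit. Proof. by []. Qed.
Definition pr : V -> zquot :=
  locked_with pr_key (fun x => \pi_{ideal_quot zspan_closed} x).
Definition rp (u : zquot) : V := repr (u : {ideal_quot zspan_closed}).

Lemma rpK u : pr (rp u) = u.
Proof. by rewrite /pr unlock; apply: reprK. Qed.

Lemma prP x y : pr x = pr y <-> zspan S (x - y).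
Proof.
rewrite /pr unlock; split=> [/eqP|] xy; last apply/eqP.
  by apply/asboolP; have := Quotient.idealrBE zspan_closed x y; rewrite xy.
by rewrite -[_ == _](Quotient.idealrBE zspan_closed); apply/asboolP.
Qed.

Lemma prB x y : pr (x - y) = pr x - pr y.
Proof. by rewrite /pr unlock; apply: (raddfB (\pi_{ideal_quot zspan_closed})). Qed.
Lemma prD x y : pr (x + y) = pr x + pr y.
Proof. by rewrite /pr unlock; apply: (raddfD (\pi_{ideal_quot zspan_closed})). Qed.

Lemma rp_pr x : zspan S (rp (pr x) - x).
Proof. by apply/prP; rewrite rpK. Qed.

End Zspan.

(* The two-sided ideal generated by the differences [x - y] with [S x y]. *)
Definition ideal_gen (F : nzRingType) (S : F -> F -> Prop) (z : F) : Prop :=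
  exists a x y b, S x y /\ z = a * (x - y) * b.

Section IdealTheory.
Variables (F : nzRingType) (S : F -> F -> Prop).

Lemma ideal_genMl c x : zspan (ideal_gen S) x -> zspan (ideal_gen S) (c * x).
Proof.
elim=> [|{}x y _ IHx _ IHy|_ [a [{}x [y [b [Sxy ->]]]]]].
- by rewrite mulr0; apply: zspan0.
- by rewrite mulrBr; apply: zspanB.
- by apply: zspan_gen; exists (c * a), x, y, b; rewrite !mulrA.
Qed.

Lemma ideal_genMr c x : zspan (ideal_gen S) x -> zspan (ideal_gen S) (x * c).
Proof.
elim=> [|{}x y _ IHx _ IHy|_ [a [{}x [y [b [Sxy ->]]]]]].
- by rewrite mul0r; apply: zspan0.
- by rewrite mulrBl; apply: zspanB.
- by apply: zspan_gen; exists a, x, y, (b * c); rewrite !mulrA.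
Qed.

End IdealTheory.

Section Presented.
Variables (A : comNzRingType) (X : choiceType).

Definition free_type : Type := {malg A[{fmonom X}]}.
HB.instance Definition _ := GRing.Lalgebra.on free_type.

Lemma free_scalerAr c (x y : free_type) : c *: (x * y) = x * (c *: y).
Proof.
have cC (z : free_type) : z * c%:MP = c%:MP * z.
  rewrite !malgM_def fgmulgU fgmulUg; apply: eq_bigr => k _.
  by rewrite mulm1 mul1m mulrC.
by rewrite -!mul_malgC !mulrA cC.
Qed.
HB.instance Definition _ :=
  GRing.Lalgebra_isAlgebra.Build A free_type free_scalerAr.

(* The free associative algebra [A<X>], that is, the algebra of the free monoid
   on [X]. It is locked, as are the products of the two algebras built below:
   unification would otherwise unfold them each time it fails. *)
Fact free_key : unit. Proof. by []. Qed.
Definition free_alg : algType A := locked_with free_key (free_type : algType A).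

Definition gen (x : X) : free_alg :=
  match free_key as k return (locked_with k (free_type : algType A)) with
  | tt => << fmu x >>
  end.

Section FreeLift.
Variables (B : algType A) (h : X -> B).

Let mon_lift (m : {fmonom X}) : B := \prod_(x <- m) h x.

Let mon_lift_mmorphism : mmorphism mon_lift.
Proof.
split=> [m1 m2|]; rewrite /mon_lift; first by rewrite fmM big_cat.
by rewrite fm1 big_nil.
Qed.
HB.instance Definition _ :=
  isMultiplicative.Build {fmonom X} B mon_lift mon_lift_mmorphism.

(* The algebra morphism [A<X> -> B] extending [h]. *)
Definition free_lift : free_alg -> B :=
  match free_key as k
    return (locked_with k (free_type : algType A) -> B) with
  | tt => mmap (in_alg B) mon_lift
  end.

Lemma free_lift_gen x : free_lift (gen x) = h x.
Proof.
rewrite /free_lift /gen; case: free_key.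
by rewrite mmapU /= scale1r mul1r /mon_lift fmU big_seq1.
Qed.

Fact free_lift_zmod : zmod_morphism free_lift.
Proof.
rewrite /free_lift /free_alg; case: free_key => x y.
exact: (raddfB (mmap (in_alg B) mon_lift)).
Qed.
HB.instance Definition _ :=
  GRing.isZmodMorphism.Build free_alg B free_lift free_lift_zmod.

Fact free_lift_monoid : monoid_morphism free_lift.
Proof.
rewrite /free_lift /free_alg; case: free_key.
have [|mM m1] := @commr_mmap_is_multiplicative _ _ _ (in_alg B) mon_lift.
  by move=> *; rewrite /GRing.comm mulr_algl mulr_algr.
by split.
Qed.
HB.instance Definition _ :=
  GRing.isMonoidMorphism.Build free_alg B free_lift free_lift_monoid.

Fact free_lift_scalable : scalable free_lift.
Proof.
rewrite /free_lift /free_alg; case: free_key => c x.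
by rewrite mmapZ /= mulr_algl.
Qed.
HB.instance Definition _ :=
  GRing.isScalable.Build A free_alg B *:%R free_lift free_lift_scalable.

End FreeLift.

Variable S : free_alg -> free_alg -> Prop.

Definition presented : Type := zquot (ideal_gen S).
HB.instance Definition _ := GRing.Zmodule.on presented.
Local Notation pr := (@pr _ (ideal_gen S) : free_alg -> presented).

Fact presented_key : unit. Proof. by []. Qed.
Definition presented_mul : presented -> presented -> presented :=
  locked_with presented_key (fun u v => pr (rp u * rp v)).
Definition presented_scale : A -> presented -> presented :=
  locked_with presented_key (fun c u => pr (c *: rp u)).

Lemma prM x y : pr (x * y) = presented_mul (pr x) (pr y).
Proof.
rewrite /presented_mul unlock; apply/esym/prP.
have -> : rp (pr x) * rp (pr y) - x * y =
  (rp (pr x) - x) * rp (pr y) - x * (y - rp (pr y)).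
  by rewrite mulrBl mulrBr opprB addrA addrNK.
apply: zspanB; first exact/ideal_genMr/rp_pr.
by apply: ideal_genMl; apply/prP; rewrite rpK.
Qed.

Lemma prZ c x : pr (c *: x) = presented_scale c (pr x).
Proof.
rewrite /presented_scale unlock; apply/prP; rewrite -scalerBr -mulr_algl.
by apply: ideal_genMl; apply/prP; rewrite rpK.
Qed.

Ltac lift_pr := repeat
  match goal with u : presented |- _ => rewrite -(rpK u); move: (rp u) => {}u end.

Lemma presented_mulA : associative presented_mul.
Proof. by move=> u v w; lift_pr; rewrite -!prM mulrA. Qed.
Lemma presented_mul1 : left_id (pr 1) presented_mul.
Proof. by move=> u; lift_pr; rewrite -prM mul1r. Qed.
Lemma presented_mulr1 : right_id (pr 1) presented_mul.
Proof. by move=> u; lift_pr; rewrite -prM mulr1. Qed.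
Lemma presented_mulDl : left_distributive presented_mul +%R.
Proof. by move=> u v w; lift_pr; rewrite -prD -!prM -prD mulrDl. Qed.
Lemma presented_mulDr : right_distributive presented_mul +%R.
Proof. by move=> u v w; lift_pr; rewrite -prD -!prM -prD mulrDr. Qed.

HB.instance Definition _ := GRing.Zmodule_isPzRing.Build presented
  presented_mulA presented_mul1 presented_mulr1
  presented_mulDl presented_mulDr.

Lemma presented_scaleA c e u :
  presented_scale c (presented_scale e u) = presented_scale (c * e) u.
Proof. by lift_pr; rewrite -!prZ scalerA. Qed.
Lemma presented_scale1 : left_id 1 presented_scale.
Proof. by move=> u; lift_pr; rewrite -prZ scale1r. Qed.
Lemma presented_scaleDr : right_distributive presented_scale +%R.
Proof. by move=> c u v; lift_pr; rewrite -prD -!prZ -prD scalerDr. Qed.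
Lemma presented_scaleDl u : {morph presented_scale^~ u : c e / c + e}.
Proof. by move=> c e; lift_pr; rewrite -!prZ -prD scalerDl. Qed.

HB.instance Definition _ := GRing.Zmodule_isLmodule.Build A presented
  presented_scaleA presented_scale1 presented_scaleDr presented_scaleDl.

Lemma presented_scalerAl (c : A) (u v : presented) : c *: (u * v) = (c *: u) * v.
Proof.
change (presented_scale c (presented_mul u v) =
        presented_mul (presented_scale c u) v).
by lift_pr; rewrite -prM -!prZ -prM scalerAl.
Qed.
Lemma presented_scalerAr (c : A) (u v : presented) : c *: (u * v) = u * (c *: v).
Proof.
change (presented_scale c (presented_mul u v) =
        presented_mul u (presented_scale c v)).
by lift_pr; rewrite -prM -!prZ -prM scalerAr.
Qed.

Section PresentedLift.
Variables (B : algType A) (h : X -> B).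
Hypothesis hS : forall x y, S x y -> free_lift h x = free_lift h y.

(* The algebra morphism [A<X | S> -> B] extending [h]. *)
Definition presented_lift (u : presented) : B := free_lift h (rp u).

Lemma free_lift_rel x : zspan (ideal_gen S) x -> free_lift h x = 0.
Proof.
elim=> [|{}x y _ IHx _ IHy|_ [a [{}x [y [b [Sxy ->]]]]]].
- exact: rmorph0.
- by rewrite rmorphB /= IHx IHy subrr.
- by rewrite !rmorphM rmorphB /= (hS Sxy) subrr mulr0 mul0r.
Qed.

Lemma presented_liftE x : presented_lift (pr x) = free_lift h x.
Proof.
by apply/eqP; rewrite -subr_eq0 -(rmorphB (free_lift h)); apply/eqP/free_lift_rel/rp_pr.
Qed.

Lemma presented_lift1 : presented_lift 1 = 1.
Proof. by rewrite presented_liftE rmorph1. Qed.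
Lemma presented_liftD (u v : presented) :
  presented_lift (u + v) = presented_lift u + presented_lift v.
Proof. by lift_pr; rewrite -prD !presented_liftE rmorphD. Qed.
Lemma presented_liftM (u v : presented) :
  presented_lift (u * v) = presented_lift u * presented_lift v.
Proof. by lift_pr; rewrite -[_ * _]prM !presented_liftE rmorphM. Qed.
Lemma presented_liftZ (c : A) (u : presented) :
  presented_lift (c *: u) = c *: presented_lift u.
Proof. by lift_pr; rewrite -[_ *: _]prZ !presented_liftE linearZ. Qed.

End PresentedLift.

End Presented.

Section Tensor.
Variables (A K : comNzRingType) (rho : {rmorphism A -> K}) (Y : algType A).

Local Notation free_ab := {malg int[(K * Y)%type]}.

Inductive tensor_rel : free_ab -> Prop :=
| tensor_addl k k' y : tensor_rel (<<(k + k', y)>> - (<<(k, y)>> + <<(k', y)>>))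
| tensor_addr k y y' : tensor_rel (<<(k, y + y')>> - (<<(k, y)>> + <<(k, y')>>))
| tensor_bal k a y : tensor_rel (<<(k * rho a, y)>> - <<(k, a *: y)>>).

(* [K (x)_A Y], with [K] an [A]-algebra through [rho]. *)
Definition tensor : Type := zquot tensor_rel.
HB.instance Definition _ := GRing.Zmodule.on tensor.

Fact tensor_key : unit. Proof. by []. Qed.
(* The pure tensor [k (x) y]. *)
Definition tens : K -> Y -> tensor :=
  locked_with tensor_key (fun k y => pr tensor_rel <<(k, y)>>).

Lemma tens_def k y : tens k y = pr tensor_rel <<(k, y)>>.
Proof. by rewrite /tens unlock. Qed.

Section Balanced.
Variable M : zmodType.

Definition balanced (f : K -> Y -> M) : Prop :=
  [/\ forall y k k', f (k + k') y = f k y + f k' y,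
      forall k y y', f k (y + y') = f k y + f k y'
    & forall k a y, f (k * rho a) y = f k (a *: y)].

Definition malg_lift (f : K -> Y -> M) (g : free_ab) : M :=
  \sum_(i <- msupp g) f i.1 i.2 *~ g@_i.

Lemma malg_liftEw f (D : {fset K * Y}) g : (msupp g `<=` D)%fset ->
  malg_lift f g = \sum_(i <- D) f i.1 i.2 *~ g@_i.
Proof.
move=> le; rewrite [LHS](big_fset_incl _ le) => //= x xd /mcoeff_outdom ->.
by rewrite mulr0z.
Qed.

Lemma malg_liftB f g h : malg_lift f (g - h) = malg_lift f g - malg_lift f h.
Proof.
rewrite (malg_liftEw f (msuppB_le g h)).
rewrite (malg_liftEw f (fsubsetUl (msupp g) (msupp h))).
rewrite (malg_liftEw f (fsubsetUr (msupp g) (msupp h))).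
by rewrite -sumrB; apply: eq_bigr => i _; rewrite mcoeffB mulrzBr.
Qed.

Lemma malg_liftU f k y : malg_lift f <<(k, y)>> = f k y.
Proof. by rewrite (malg_liftEw _ msuppU_le) big_seq_fset1 mcoeffUU. Qed.

Definition tens_lift (f : K -> Y -> M) (u : tensor) : M := malg_lift f (rp u).

Lemma malg_liftN f g : malg_lift f (- g) = - malg_lift f g.
Proof.
have f0 : malg_lift f 0 = 0 by have := malg_liftB f 0 0; rewrite !subrr.
by rewrite -(sub0r g) malg_liftB f0 sub0r.
Qed.

Lemma malg_liftD f g h : malg_lift f (g + h) = malg_lift f g + malg_lift f h.
Proof. by rewrite -[h in LHS]opprK malg_liftB malg_liftN opprK. Qed.

Lemma tens_lift_pr f g : balanced f -> tens_lift f (pr tensor_rel g) = malg_lift f g.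
Proof.
move=> [fDl fDr fb]; apply/eqP; rewrite -subr_eq0 -malg_liftB; apply/eqP.
elim: (rp_pr tensor_rel g) => [|x y _ IHx _ IHy|x].
- by have := malg_liftB f 0 0; rewrite !subrr.
- by rewrite malg_liftB IHx IHy subrr.
- by case=> *; rewrite malg_liftB ?malg_liftD !malg_liftU ?(fDl, fDr, fb) subrr.
Qed.

Lemma tens_liftE f k y : balanced f -> tens_lift f (tens k y) = f k y.
Proof. by move=> bf; rewrite tens_def tens_lift_pr // malg_liftU. Qed.

Lemma tens_liftB f u v : balanced f ->
  tens_lift f (u - v) = tens_lift f u - tens_lift f v.
Proof.
move=> bf; rewrite -{1}(rpK u) -{1}(rpK v) -prB tens_lift_pr //.
by rewrite malg_liftB.
Qed.

Lemma tens_liftD f u v : balanced f ->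
  tens_lift f (u + v) = tens_lift f u + tens_lift f v.
Proof.
move=> bf; rewrite -{1}(rpK u) -{1}(rpK v) -prD tens_lift_pr //.
by rewrite malg_liftD.
Qed.

End Balanced.

Lemma tensDl y k k' : tens (k + k') y = tens k y + tens k' y.
Proof. by rewrite !tens_def -prD; apply/prP/zspan_gen/tensor_addl. Qed.
Lemma tensDr k y y' : tens k (y + y') = tens k y + tens k y'.
Proof. by rewrite !tens_def -prD; apply/prP/zspan_gen/tensor_addr. Qed.
Lemma tens_bal k a y : tens (k * rho a) y = tens k (a *: y).
Proof. by rewrite !tens_def; apply/prP/zspan_gen/tensor_bal. Qed.

Lemma tensor_ind (P : tensor -> Prop) :
  (forall k y, P (tens k y)) -> (forall u v, P u -> P v -> P (u - v)) ->
  forall u, P u.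
Proof.
move=> Pt PB u.
have P0 : P 0 by rewrite -(subrr (tens 0 0)); apply: PB.
have PN v : P v -> P (- v) by move=> Pv; rewrite -sub0r; apply: PB.
have PD v w : P v -> P w -> P (v + w).
  by move=> Pv Pw; rewrite -[w]opprK; apply: PB => //; apply: PN.
have PMn v n : P v -> P (v *+ n).
  by move=> Pv; elim: n => [|n IHn]; rewrite ?mulr0n // mulrS; apply: PD.
have pr0 : pr tensor_rel 0 = 0 by have := prB tensor_rel 0 0; rewrite !subrr.
have prN x : pr tensor_rel (- x) = - pr tensor_rel x.
  by rewrite -sub0r prB pr0 sub0r.
have prMn x n : pr tensor_rel (x *+ n) = pr tensor_rel x *+ n.
  by elim: n => [|n IHn]; rewrite ?mulr0n // !mulrS prD IHn.
rewrite -(rpK u) (monalgE (rp u)).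
elim: (X in pr _ (\sum_(i <- X) _)) => [|[k y] s IHs]; first by rewrite big_nil pr0.
rewrite big_cons prD; apply: PD => {IHs}//.
set z := (rp u)@_(k, y).
have -> : << z *g (k, y) >> = <<(k, y)>> *~ z.
  by rewrite -{1}[z]intz -raddfMz.
by case: z => n; rewrite ?NegzE ?mulrNz ?prN; [|apply: PN];
  rewrite -pmulrn prMn -tens_def; apply/PMn/Pt.
Qed.

Definition tensor_scale : K -> tensor -> tensor :=
  locked_with tensor_key (fun c => tens_lift (fun k y => tens (c * k) y)).

Lemma tensor_scale_def c u :
  tensor_scale c u = tens_lift (fun k y => tens (c * k) y) u.
Proof. by rewrite /tensor_scale unlock. Qed.

Lemma tensor_scale_bal c : balanced (fun k y => tens (c * k) y).
Proof.
by split=> *; rewrite ?mulrDr ?mulrA ?(tensDl, tensDr, tens_bal).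
Qed.

Definition tensor_mul : tensor -> tensor -> tensor :=
  locked_with tensor_key (fun u v =>
    tens_lift (fun k y => tens_lift (fun k' y' => tens (k * k') (y * y')) v) u).

Lemma tensor_mul_def u v : tensor_mul u v =
  tens_lift (fun k y => tens_lift (fun k' y' => tens (k * k') (y * y')) v) u.
Proof. by rewrite /tensor_mul unlock. Qed.

Lemma tensor_mul_balr k y : balanced (fun k' y' => tens (k * k') (y * y')).
Proof.
split=> *; rewrite ?mulrDr ?tensDl ?tensDr //.
by rewrite mulrA tens_bal scalerAr.
Qed.

Lemma tensor_mul_ball v :
  balanced (fun k y => tens_lift (fun k' y' => tens (k * k') (y * y')) v).
Proof.
have B := tensor_mul_balr.
split=> [y k k'|k y y'|k a y]; elim/tensor_ind: v => [l z|u v IHu IHv];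
  rewrite ?tens_liftE ?tens_liftB //.
- by rewrite mulrDl tensDl.
- by rewrite IHu IHv opprD addrACA.
- by rewrite mulrDl tensDr.
- by rewrite IHu IHv opprD addrACA.
- by rewrite mulrAC tens_bal scalerAl.
- by rewrite IHu IHv.
Qed.

Lemma tensor_mulBl u v w : tensor_mul (u - v) w = tensor_mul u w - tensor_mul v w.
Proof. by rewrite !tensor_mul_def; apply/tens_liftB/tensor_mul_ball. Qed.

Lemma tensor_mulE k y k' y' :
  tensor_mul (tens k y) (tens k' y') = tens (k * k') (y * y').
Proof.
by rewrite tensor_mul_def tens_liftE ?tens_liftE //;
  [apply: tensor_mul_balr|apply: tensor_mul_ball].
Qed.

Lemma tensor_mulBr u v w : tensor_mul w (u - v) = tensor_mul w u - tensor_mul w v.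
Proof.
elim/tensor_ind: w => [k y|w w' IHw IHw'].
  rewrite !tensor_mul_def !tens_liftE; try exact: tensor_mul_ball.
  exact/tens_liftB/tensor_mul_balr.
rewrite !tensor_mulBl IHw IHw' !opprB addrACA [RHS]addrACA.
by congr (_ + _); rewrite addrC.
Qed.

Lemma tensor_scaleE c k y : tensor_scale c (tens k y) = tens (c * k) y.
Proof. by rewrite tensor_scale_def; apply/tens_liftE/tensor_scale_bal. Qed.
Lemma tensor_scaleBr c u v :
  tensor_scale c (u - v) = tensor_scale c u - tensor_scale c v.
Proof. by rewrite !tensor_scale_def; apply/tens_liftB/tensor_scale_bal. Qed.

Lemma tensor_mulA : associative tensor_mul.
Proof.
move=> u v w.
elim/tensor_ind: u => [k y|? ? IH1 IH2]; last by rewrite !tensor_mulBl IH1 IH2.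
elim/tensor_ind: v => [k1 y1|? ? IH1 IH2].
  elim/tensor_ind: w => [k2 y2|? ? IH1 IH2]; last by rewrite !tensor_mulBr IH1 IH2.
  by rewrite !tensor_mulE !mulrA.
by rewrite !(tensor_mulBl, tensor_mulBr) IH1 IH2.
Qed.

Lemma tensor_mul1 : left_id (tens 1 1) tensor_mul.
Proof.
move=> u; elim/tensor_ind: u => [k y|u v IHu IHv].
  by rewrite tensor_mulE !mul1r.
by rewrite tensor_mulBr IHu IHv.
Qed.

Lemma tensor_mulr1 : right_id (tens 1 1) tensor_mul.
Proof.
move=> u; elim/tensor_ind: u => [k y|u v IHu IHv].
  by rewrite tensor_mulE !mulr1.
by rewrite tensor_mulBl IHu IHv.
Qed.

Lemma tensor_mulDl : left_distributive tensor_mul +%R.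
Proof.
by move=> u v w; rewrite !tensor_mul_def; apply/tens_liftD/tensor_mul_ball.
Qed.

Lemma tensor_mulDr : right_distributive tensor_mul +%R.
Proof.
move=> w u v; rewrite -{1}[v]opprK tensor_mulBr -[- v]sub0r tensor_mulBr.
by rewrite opprB addrCA -[0](subrr v) tensor_mulBr subrr subr0 addrC.
Qed.

HB.instance Definition _ := GRing.Zmodule_isPzRing.Build tensor
  tensor_mulA tensor_mul1 tensor_mulr1 tensor_mulDl tensor_mulDr.

Lemma tensor_scaleA c e u :
  tensor_scale c (tensor_scale e u) = tensor_scale (c * e) u.
Proof.
elim/tensor_ind: u => [k y|u v IHu IHv]; first by rewrite !tensor_scaleE mulrA.
by rewrite !tensor_scaleBr IHu IHv.
Qed.

Lemma tensor_scale1 : left_id 1 tensor_scale.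
Proof.
move=> u; elim/tensor_ind: u => [k y|u v IHu IHv].
  by rewrite tensor_scaleE mul1r.
by rewrite tensor_scaleBr IHu IHv.
Qed.

Lemma tensor_scaleDr : right_distributive tensor_scale +%R.
Proof.
by move=> c u v; rewrite !tensor_scale_def; apply/tens_liftD/tensor_scale_bal.
Qed.

Lemma tensor_scaleDl u : {morph tensor_scale^~ u : c e / c + e}.
Proof.
move=> c e; elim/tensor_ind: u => [k y|u v IHu IHv].
  by rewrite !tensor_scaleE mulrDl tensDl.
by rewrite !tensor_scaleBr IHu IHv opprD addrACA.
Qed.

HB.instance Definition _ := GRing.Zmodule_isLmodule.Build K tensor
  tensor_scaleA tensor_scale1 tensor_scaleDr tensor_scaleDl.

Lemma tensor_scalerAl (c : K) (u v : tensor) : c *: (u * v) = (c *: u) * v.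
Proof.
change (tensor_scale c (tensor_mul u v) = tensor_mul (tensor_scale c u) v).
elim/tensor_ind: u => [k y|? ? IH1 IH2]; last first.
  by rewrite !(tensor_mulBl, tensor_scaleBr) IH1 IH2.
elim/tensor_ind: v => [k' y'|? ? IH1 IH2]; last first.
  by rewrite !(tensor_mulBr, tensor_scaleBr) IH1 IH2.
by rewrite !(tensor_mulE, tensor_scaleE) mulrA.
Qed.

Lemma tensor_scalerAr (c : K) (u v : tensor) : c *: (u * v) = u * (c *: v).
Proof.
change (tensor_scale c (tensor_mul u v) = tensor_mul u (tensor_scale c v)).
elim/tensor_ind: u => [k y|? ? IH1 IH2]; last first.
  by rewrite !(tensor_mulBl, tensor_scaleBr) IH1 IH2.
elim/tensor_ind: v => [k' y'|? ? IH1 IH2]; last first.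
  by rewrite !(tensor_mulBr, tensor_scaleBr) IH1 IH2.
by rewrite !(tensor_mulE, tensor_scaleE) mulrCA.
Qed.

End Tensor.

Section Laurent.
Variable R : realType.

(* [C(q)], the indeterminate being ['X]. *)
Definition ratfun : fieldType := {fraction {poly R[i]}}.

Definition poly_ratfun : {rmorphism {poly R[i]} -> ratfun} :=
  @FracField.tofrac {poly R[i]}.

(* [C[q, q^-1]], as a subring of [C(q)]. *)
Definition laurent_pred : pred ratfun := fun x =>
  `[< exists (p : {poly R[i]}) (k : nat), x = poly_ratfun p / poly_ratfun 'X ^+ k >].

Lemma poly_ratfunX_neq0 : poly_ratfun 'X != 0.
Proof. by rewrite tofrac_eq0 polyX_eq0. Qed.

Lemma laurent_pred_closed : subring_closed laurent_pred.
Proof.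
have X0 k : poly_ratfun 'X ^+ k != 0 by rewrite expf_neq0 ?poly_ratfunX_neq0.
split=> [|_ _ /asboolP[p [k ->]] /asboolP[p' [k' ->]]
         |_ _ /asboolP[p [k ->]] /asboolP[p' [k' ->]]]; apply/asboolP.
- by exists 1, 0%N; rewrite rmorph1 expr0 divr1.
- exists (p * 'X^k' - p' * 'X^k), (k + k')%N.
  rewrite rmorphB !rmorphM !rmorphXn exprD -[- (_ / _)]mulNr addf_div //.
  by rewrite mulNr.
- by exists (p * p'), (k + k')%N; rewrite rmorphM exprD mulf_div.
Qed.
HB.instance Definition _ :=
  GRing.isSubringClosed.Build ratfun laurent_pred laurent_pred_closed.

Record laurent_type :=
  Laurent { laurent_val : ratfun; _ : laurent_val \in laurent_pred }.
HB.instance Definition _ := [isSub for laurent_val].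
HB.instance Definition _ := [Choice of laurent_type by <:].
HB.instance Definition _ := [SubChoice_isSubComNzRing of laurent_type by <:].

Definition laurent : comNzRingType := laurent_type.
Definition laurent_incl : {rmorphism laurent -> ratfun} :=
  (val : laurent_type -> ratfun).

Lemma laurent_incl_inj : injective laurent_incl.
Proof. exact: val_inj. Qed.

Fact poly_laurent_subproof (p : {poly R[i]}) : poly_ratfun p \in laurent_pred.
Proof. by apply/asboolP; exists p, 0%N; rewrite expr0 divr1. Qed.
Definition poly_laurent (p : {poly R[i]}) : laurent :=
  Laurent (poly_laurent_subproof p).

Lemma poly_laurentE p : laurent_incl (poly_laurent p) = poly_ratfun p.
Proof. by []. Qed.

End Laurent.

Section YokonumaHecke.
Variables (R : realType) (d n : nat).

Definition q_ : laurent R := poly_laurent 'X.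

Fact succ_subproof (i : 'I_n.-1) : (i.+1 < n)%N.
Proof. by rewrite -ltn_predRL. Qed.
Definition ord_cur (i : 'I_n.-1) : 'I_n := widen_ord (leq_pred n) i.
Definition ord_next (i : 'I_n.-1) : 'I_n := Ordinal (succ_subproof i).

(* The defining relations, between elements [g_1, ..., g_(n-1)] and
   [t_1, ..., t_n] of an algebra; the indices are shifted to start at [0]. *)
Section Relations.
Variables (F : lalgType (laurent R)) (g : 'I_n.-1 -> F) (t : 'I_n -> F).

(* [t_(i+1) ^+ (d - s)] stands for [t_(i+1)^-s], as [t_(i+1) ^+ d = 1]. *)
Definition yh_e (i : 'I_n.-1) : F :=
  poly_laurent (d%:R^-1)%:P *:
    \sum_(s < d) t (ord_cur i) ^+ s * t (ord_next i) ^+ (d - s).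

Inductive yh_rel : F -> F -> Prop :=
| yh_gg (i j : 'I_n.-1) : (i.+1 < j)%N || (j.+1 < i)%N ->
    yh_rel (g i * g j) (g j * g i)
| yh_braid (i j : 'I_n.-1) : j = i.+1 :> nat ->
    yh_rel (g i * g j * g i) (g j * g i * g j)
| yh_tt i j : yh_rel (t i * t j) (t j * t i)
| yh_tg i j : yh_rel (t j * g i) (g i * t (tperm (ord_cur i) (ord_next i) j))
| yh_td j : yh_rel (t j ^+ d) 1
| yh_gquad i : yh_rel (g i ^+ 2) (q_ *: 1 + (q_ - 1) *: (yh_e i * g i)).

Lemma yh_rel_char (ev : {rmorphism F -> (laurent R)^o}) x y : (0 < d)%N ->
  (forall c z, ev (c *: z) = c * ev z) ->
  (forall i, ev (g i) = q_) -> (forall j, ev (t j) = 1) ->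
  yh_rel x y -> ev x = ev y.
Proof.
move=> d_gt0 evZ evg evt; case=> [i j _|i j _|i j|i j|j|i].
- by rewrite !rmorphM !evg mulrC.
- by rewrite !rmorphM !evg.
- by rewrite !rmorphM !evt.
- by rewrite !rmorphM !evg !evt mulrC.
- by rewrite rmorphXn evt expr1n rmorph1.
rewrite rmorphXn rmorphD evg !evZ rmorph1 rmorphM evg evZ rmorph_sum.
under eq_bigr do rewrite rmorphM !rmorphXn !evt !expr1n mulr1.
rewrite sumr_const card_ord mulr1.
have -> : poly_laurent (d%:R^-1)%:P * d%:R = 1 :> laurent R.
  apply: laurent_incl_inj; rewrite rmorphM rmorph_nat rmorph1 poly_laurentE.
  rewrite -(rmorph_nat (poly_ratfun R)) -rmorphM -polyC_natr -polyCM.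
  by rewrite mulVf ?rmorph1 // pnatr_eq0 -lt0n.
by rewrite mul1r mulrBl mul1r addrC subrK expr2.
Qed.

End Relations.

(* Indices of the generators: [g_i] on the left, [t_j] on the right. *)
Definition yh_gen : choiceType := ('I_n.-1 + 'I_n)%type.
Definition yh_free : algType (laurent R) := free_alg (laurent R) yh_gen.
Definition free_g (i : 'I_n.-1) : yh_free := gen (laurent R) (inl i : yh_gen).
Definition free_t (j : 'I_n) : yh_free := gen (laurent R) (inr j : yh_gen).

(* The character [g_i |-> q], [t_j |-> 1]. *)
Definition yh_char0 (x : yh_gen) : (laurent R)^o :=
  if x is inl _ then q_ else 1.

Lemma yh_char0_rel x y : (0 < d)%N -> yh_rel free_g free_t x y ->
  free_lift yh_char0 x = free_lift yh_char0 y.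
Proof.
move=> d_gt0.
apply: (yh_rel_char (ev := free_lift yh_char0)) => // [c z|i|j].
- exact: linearZ.
- exact: free_lift_gen.
- exact: free_lift_gen.
Qed.

End YokonumaHecke.

Section YokonumaHeckeAlgebra.
Variables (R : realType) (d n : nat) (d_gt0 : (0 < d)%N).

Definition yh_type of (0 < d)%N : Type :=
  presented (yh_rel d (@free_g R n) (@free_t R n)).
Local Notation Y := (yh_type d_gt0).
HB.instance Definition _ := GRing.PzRing.on Y.
HB.instance Definition _ := GRing.Lmodule.on Y.

Definition yh_char : Y -> (laurent R)^o := presented_lift (@yh_char0 R n).

Lemma yh_char1 : yh_char 1 = 1.
Proof. exact: (presented_lift1 (fun x y => @yh_char0_rel R d n x y d_gt0)). Qed.
Lemma yh_charD (u v : Y) : yh_char (u + v) = yh_char u + yh_char v.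
Proof. exact: (presented_liftD (fun x y => @yh_char0_rel R d n x y d_gt0)). Qed.
Lemma yh_charZ c (u : Y) : yh_char (c *: u) = c * yh_char u.
Proof. exact: (presented_liftZ (fun x y => @yh_char0_rel R d n x y d_gt0)). Qed.

Lemma yh_nonzero : (1 : Y) != 0.
Proof.
apply/eqP => /(congr1 yh_char); rewrite yh_char1 -(scale0r (0 : Y)) yh_charZ.
by rewrite mul0r; apply/eqP; rewrite oner_eq0.
Qed.
HB.instance Definition _ := GRing.PzSemiRing_isNonZero.Build Y yh_nonzero.
HB.instance Definition _ := GRing.Lmodule_isLalgebra.Build (laurent R) Y
  (@presented_scalerAl _ _ _).
HB.instance Definition _ := GRing.Lalgebra_isAlgebra.Build (laurent R) Y
  (@presented_scalerAr _ _ _).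

(* [Y_(d,n)(q)] over [C[q, q^-1]]; [d_gt0] ensures that [1 != 0]. *)
Definition yokonuma_hecke : algType (laurent R) := Y.

Definition yhq_type of (0 < d)%N : Type :=
  tensor (laurent_incl R) yokonuma_hecke.
Local Notation YK := (yhq_type d_gt0).
HB.instance Definition _ := GRing.PzRing.on YK.
HB.instance Definition _ := GRing.Lmodule.on YK.

Lemma yhq_nonzero : (1 : YK) != 0.
Proof.
pose f (k : ratfun R) (y : yokonuma_hecke) : ratfun R :=
  k * laurent_incl R (yh_char y).
have bf : balanced (laurent_incl R) f.
  split=> *; rewrite /f; first by rewrite mulrDl.
    by rewrite yh_charD rmorphD mulrDr.
  by rewrite yh_charZ rmorphM mulrA.
apply/eqP => /(congr1 (tens_lift f)).
rewrite -[0 in RHS](subrr (1 : YK)) tens_liftB // subrr.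
rewrite (tens_liftE _ _ bf) /f yh_char1 rmorph1 mulr1.
by apply/eqP; rewrite oner_eq0.
Qed.
HB.instance Definition _ := GRing.PzSemiRing_isNonZero.Build YK yhq_nonzero.
HB.instance Definition _ := GRing.Lmodule_isLalgebra.Build (ratfun R) YK
  (@tensor_scalerAl _ _ _ _).
HB.instance Definition _ := GRing.Lalgebra_isAlgebra.Build (ratfun R) YK
  (@tensor_scalerAr _ _ _ _).

(* [C(q) (x)_(C[q, q^-1]) Y_(d,n)(q)] *)
Definition yokonuma_hecke_q : algType (ratfun R) := YK.

End YokonumaHeckeAlgebra.

Arguments yokonuma_hecke R d n d_gt0 : clear implicits.
Arguments yokonuma_hecke_q R d n d_gt0 : clear implicits.

(* Main.v *)
(* Let [jm k] be the Jucys-Murphy elements, [alg m] the subalgebra generated by all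
   the [t_j] and by [g_0, ..., g_(m-2)], and [twist m = jm 0 * ... * jm (m-1)],
   which is central in [alg m].

   Maschke: averaging a linear projection by [f |-> sum_k q^k X_k f X_k^*], where
   [X_k = g_k ... g_(m-1)] and [X_k^*] is its reverse, makes it commute with
   [alg m]; on its image the identity becomes the multiplication by an element
   [casimir m]. The latter is a nonzero integer modulo [q - 1] on a [C[q]]-lattice, hence it is invertible over
   [C(q)]. No basis theorem is needed, only a finite spanning set.

   Consequently [(twist m - c) ^ 2 y = 0] implies [(twist m - c) y = 0]: compose with
   the averaged projection onto the kernel of [twist m - c]. The intertwiner
   [tau = g J - J g] shows moreover that the eigenvalues of [jm m] lie in [C(q)].
   So the [t_j] and the [twist k] are simultaneously diagonalizable: [1] is a sum of weight
   idempotents [p]. By induction on [m] along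
   [alg (m+2) = alg (m+1) + alg (m+1) g_m alg (m+1)] one gets [p B p = C(q) p];
   an endomorphism of a simple module [V] then acts by a scalar on some [p v != 0],
   hence on [V]. *)

From HB Require Import structures.
Require Import Defs.
From mathcomp Require Import all_boot perm all_algebra zify ring.
From mathcomp Require Import boolp reals complex monalg separable cyclotomic.

Set Implicit Arguments.
Unset Strict Implicit.
Unset Printing Implicit Defensive.

Import GRing.Theory.
Local Open Scope ring_scope.

(** * Linear algebra *)

Section Complement.
Variables (K : fieldType) (V : lmodType K).

Definition lin_closed (S : V -> Prop) : Prop :=
  S 0 /\ forall c u v, S u -> S v -> S (c *: u + v).

Lemma lin_closedD S u v : lin_closed S -> S u -> S v -> S (u + v).
Proof. by case=> _ + Su Sv => /(_ 1 u v Su Sv); rewrite scale1r. Qed.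

Lemma lin_closedZ S c u : lin_closed S -> S u -> S (c *: u).
Proof. by case=> S0 /(_ c u 0) + Su => /(_ Su S0); rewrite addr0. Qed.

Lemma lin_closedB S u v : lin_closed S -> S u -> S v -> S (u - v).
Proof. by case=> _ + Su Sv => /(_ (-1) v u Sv Su); rewrite scaleN1r addrC. Qed.

Lemma lin_closed_sum S (I : eqType) (r : seq I) (F : I -> V) : lin_closed S ->
  (forall i, i \in r -> S (F i)) -> S (\sum_(i <- r) F i).
Proof.
move=> cS SF; rewrite big_seq; elim/big_ind: _ => //; first by case: cS.
by move=> u v; apply: lin_closedD.
Qed.

(** The span is the intersection of all subspaces containing [s], so that a proof about it starts by
    choosing the subspace. *)
Definition lin_span (s : seq V) (v : V) : Prop :=
  forall S, lin_closed S -> (forall x, x \in s -> S x) -> S v.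

(** Induction on [s]: a vector [x] outside [S + C] is added to [C], and one inside changes nothing.
    Excluded middle decides which case holds. *)
Lemma lin_complement (s : seq V) (S : V -> Prop) : lin_closed S ->
  exists C, [/\ lin_closed C, forall v, S v -> C v -> v = 0
    & forall v, lin_span s v -> exists u w, [/\ S u, C w & v = u + w]].
Proof.
move=> cS; suff [C [cC C0 Cs]] : exists C, [/\ lin_closed C,
    forall v, S v -> C v -> v = 0
    & forall v, v \in s -> exists u w, [/\ S u, C w & v = u + w]].
  exists C; split=> // v sv.
  apply: (sv (fun v => exists u w, [/\ S u, C w & v = u + w])) => //; split.
    by exists 0, 0; rewrite addr0; split=> //; [case: cS|case: cC].
  move=> c _ _ [u [w [Su Cw ->]]] [u' [w' [Su' Cw' ->]]].
  exists (c *: u + u'), (c *: w + w'); rewrite scalerDr addrACA.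
  by split=> //; [case: cS => _|case: cC => _]; apply.
elim: s => [|x s [C [cC C0 Cs]]].
  exists (eq^~ 0); split=> //; first by split=> // c u v -> ->; rewrite scaler0 addr0.
have [[u [w [Su Cw xE]]]|nx] := pselect (exists u w, [/\ S u, C w & x = u + w]).
  exists C; split=> // v; rewrite in_cons => /predU1P[->|]; last exact: Cs.
  by exists u, w.
pose C' v := exists k w, C w /\ v = k *: x + w.
have CC' w : C w -> C' w by exists 0, w; rewrite scale0r add0r.
exists C'; split=> [|v Sv [k [w [Cw vE]]]|v].
- split; first by apply: CC'; case: cC.
  move=> c _ _ [k [w [Cw ->]]] [k' [w' [Cw' ->]]].
  exists (c * k + k'), (c *: w + w'); split; first by case: cC => _; apply.
  by rewrite scalerDr scalerA addrACA -scalerDl.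
(* If [k] were nonzero, solving [v = k *: x + w] for [x] would place [x] in [S + C]. *)
- have [k0|k0] := eqVneq k 0.
    by move: vE; rewrite k0 scale0r add0r => vE; apply: C0; rewrite ?vE // -vE.
  case: nx; exists (k^-1 *: v), (- (k^-1 *: w)); split.
  + exact: lin_closedZ.
  + by rewrite -scaleN1r; do 2!apply: (lin_closedZ _ cC).
  + by rewrite vE scalerDr scalerA mulVf // scale1r addrK.
- rewrite in_cons => /predU1P[->|/Cs[u [w [Su Cw ->]]]].
    exists 0, x; split; [by case: cS| |by rewrite add0r].
    by exists 1, 0; rewrite scale1r addr0; split=> //; case: cC.
  by exists u, w; split=> //; apply: CC'.
Qed.

Lemma lin_projection (s : seq V) (S : V -> Prop) : lin_closed S ->
  (forall v, lin_span s v) ->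
  exists p : V -> V, [/\ linear p, forall v, S (p v) & forall v, S v -> p v = v].
Proof.
move=> cS sV; have [C [cC C0 /(_ _ (sV _))VE]] := lin_complement s cS.
have uniq_dec u w u' w' : S u -> C w -> S u' -> C w' -> u + w = u' + w' -> u = u'.
  move=> Su Cw Su' Cw' E.
  have E' : u - u' = w' - w by rewrite -[u](addrK w) E [u' + w']addrC addrAC addrK.
  apply/eqP; rewrite -subr_eq0; apply/eqP/C0; first exact: lin_closedB.
  by rewrite E'; apply: lin_closedB.
have /choice[p pP] v : exists u, S u /\ exists2 w, C w & v = u + w.
  by have [u [w [Su Cw ->]]] := VE v; exists u; split=> //; exists w.
exists p; split=> [c u v|v|v Sv]; last 1 first.
- have [Sp [w Cw E]] := pP v.
  apply: (uniq_dec (p v) w v 0) => //; first by case: cC.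
  by rewrite -E addr0.
- have [Spu [wu Cwu uE]] := pP u; have [Spv [wv Cwv vE]] := pP v.
  have [Sp [w Cw E]] := pP (c *: u + v).
  apply: (uniq_dec _ w _ (c *: wu + wv)) => //.
  + by case: cS => _; apply.
  + by case: cC => _; apply.
  + by rewrite -E {1}uE {1}vE scalerDr addrACA.
- by have [] := pP v.
Qed.

End Complement.

(** * Diagonalizable elements and simultaneous diagonalization *)

Section Diagonalizable.
Variables (K : fieldType) (B : algType K).
Implicit Types (x y w p : B) (rs : seq K) (f : {poly K}).

Lemma horner_alg_intertwine x x' y f :
  x * y = y * x' -> horner_alg x f * y = y * horner_alg x' f.
Proof.
move=> xy; elim/poly_ind: f => [|f c IHf]; first by rewrite !rmorph0 mulr0 mul0r.
rewrite !rmorphD !rmorphM /= !horner_algX !horner_algC mulrDl mulrDr -mulrA xy.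
by rewrite !mulrA IHf mulr_algl mulr_algr.
Qed.

Lemma horner_alg_eigen x w a f : x * w = a *: w -> horner_alg x f * w = f.[a] *: w.
Proof.
move=> xw; elim/poly_ind: f => [|f c IHf]; first by rewrite rmorph0 mul0r horner0 scale0r.
rewrite rmorphD rmorphM /= horner_algX horner_algC mulrDl -mulrA xw -scalerAr IHf.
by rewrite hornerMXaddC scalerDl scalerA mulr_algl mulrC.
Qed.

Definition roots_poly rs : {poly K} := \prod_(r <- rs) ('X - r%:P).
Definition split_elt x := exists rs, horner_alg x (roots_poly rs) = 0.
Definition diag_elt x := exists2 rs, uniq rs & horner_alg x (roots_poly rs) = 0.

Lemma horner_alg_XsubC x r : horner_alg x ('X - r%:P) = x - r%:A.
Proof. by rewrite rmorphB /= horner_algX horner_algC. Qed.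

Lemma roots_poly_cons r rs : roots_poly (r :: rs) = ('X - r%:P) * roots_poly rs.
Proof. by rewrite /roots_poly big_cons. Qed.

Lemma horner_roots_cons x r rs :
  horner_alg x (roots_poly (r :: rs)) = horner_alg x (roots_poly rs) * (x - r%:A).
Proof. by rewrite roots_poly_cons mulrC rmorphM /= horner_alg_XsubC. Qed.

Lemma split_diag x : split_elt x ->
  (forall c y, (x - c%:A) * ((x - c%:A) * y) = 0 -> (x - c%:A) * y = 0) ->
  diag_elt x.
Proof.
move=> [rs rs0] red; exists (undup rs); first exact: undup_uniq.
suff H y : horner_alg x (roots_poly rs) * y = 0 ->
    horner_alg x (roots_poly (undup rs)) * y = 0.
  by rewrite -[LHS]mulr1; apply: H; rewrite rs0 mul0r.
elim: rs y {rs0} => [|r rs IHrs] y //=.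
rewrite horner_roots_cons -mulrA => /IHrs.
case: ifP => [|_]; last first.
  by rewrite horner_roots_cons mulrA.
rewrite -mem_undup => rs_r.
have -> : roots_poly (undup rs) = ('X - r%:P) * roots_poly (rem r (undup rs)).
  by rewrite -roots_poly_cons; apply: perm_big; apply: perm_to_rem.
set Q := roots_poly _.
have QC : horner_alg x Q * (x - r%:A) = (x - r%:A) * horner_alg x Q.
  by rewrite -horner_alg_XsubC -!rmorphM /= mulrC.
by rewrite rmorphM /= horner_alg_XsubC -!mulrA [horner_alg x Q * _]mulrA QC -mulrA => /red.
Qed.

Definition lagrange_poly rs r : {poly K} :=
  (roots_poly (rem r rs)).[r]^-1 *: roots_poly (rem r rs).

Lemma roots_poly_neq0 rs r : r \notin rs -> (roots_poly rs).[r] != 0.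
Proof. by rewrite -[_ == 0]/(root _ r) root_prod_XsubC. Qed.

Lemma lagrange_poly_self rs r : uniq rs -> (lagrange_poly rs r).[r] = 1.
Proof.
by move=> urs; rewrite hornerZ mulVf // roots_poly_neq0 // mem_rem_uniq // inE eqxx.
Qed.

Lemma lagrange_poly_other rs r s : uniq rs -> s \in rs -> s != r ->
  (lagrange_poly rs r).[s] = 0.
Proof.
move=> urs srs sr; apply/eqP; rewrite hornerZ mulf_eq0 orbC -[_ == 0]/(root _ s).
by rewrite root_prod_XsubC mem_rem_uniq // inE sr srs.
Qed.

(** The difference with 1 has degree below [size rs] and vanishes at every element of [rs]. *)
Lemma sum_lagrange_poly rs : uniq rs -> rs != [::] ->
  \sum_(r <- rs) lagrange_poly rs r = 1.
Proof.
move=> urs rs0; apply/eqP; rewrite -subr_eq0; apply/eqP/(roots_geq_poly_eq0 _ urs).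
  apply/allP => s srs; rewrite /root hornerD hornerN hornerC horner_sum.
  rewrite (bigD1_seq s) //= lagrange_poly_self // big1 ?addr0 ?subrr // => r rs'.
  by apply: lagrange_poly_other => //; rewrite eq_sym.
rewrite (leq_trans (size_polyD _ _)) // geq_max size_polyN size_poly1.
apply/andP; split; last by case: rs rs0 {urs}.
rewrite (leq_trans (size_sum _ _ _)) //; apply/bigmax_leqP_seq => r rrs _.
rewrite (leq_trans (size_scale_leq _ _)) // size_prod_XsubC size_rem //.
by case: rs rs0 {urs rrs}.
Qed.

Definition subalg_closed_prop (P : B -> Prop) : Prop :=
  [/\ forall c, P c%:A, forall x y, P x -> P y -> P (x + y)
    & forall x y, P x -> P y -> P (x * y)].

Lemma subalg_horner P x f : subalg_closed_prop P -> P x -> P (horner_alg x f).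
Proof.
case=> PC PD PM Px; elim/poly_ind: f => [|f c IHf].
  by rewrite rmorph0 -[0](scale0r 1).
by rewrite rmorphD rmorphM /= horner_algX horner_algC; apply: PD; first apply: PM.
Qed.

(** Each new [x] refines the idempotents found so far by its own Lagrange idempotents. All of them
    are polynomials in [xs], hence lie in any subalgebra [P] containing [xs] and commute with
    whatever commutes with [xs]. *)
Lemma simul_diag (P : B -> Prop) (xs : seq B) : subalg_closed_prop P ->
  (forall x, x \in xs -> diag_elt x /\ P x) ->
  (forall x y, x \in xs -> y \in xs -> x * y = y * x) ->
  exists2 ps : seq B, \sum_(p <- ps) p = 1 & forall p, p \in ps ->
   [/\ p * p = p, P p, forall y, (forall x, x \in xs -> x * y = y * x) -> p * y = y * p
     & forall x, x \in xs -> exists a, x * p = a *: p].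
Proof.
move=> cP; elim: xs => [|x xs IHxs] xsP xsC.
  exists [:: 1]; first by rewrite big_seq1.
  move=> p; rewrite inE => /eqP->; split=> [|| y _|//]; rewrite ?mulr1 ?mul1r //.
  by case: cP => /(_ 1); rewrite scale1r.
have [y ys|y z ys zs|ps ps1 psP] := IHxs.
- by apply: xsP; rewrite inE ys orbT.
- by apply: xsC; rewrite inE (ys, zs) orbT.
have [[rs urs rs0] Px] := xsP x (mem_head _ _).
have rsn : rs != [::].
  by apply/eqP => E; move: rs0; rewrite E /roots_poly big_nil rmorph1 => /eqP; rewrite oner_eq0.
(* [pi r] projects onto the eigenspace of [x] for [r]. *)
pose pi r := horner_alg x (lagrange_poly rs r).
have xpi r : r \in rs -> x * pi r = r *: pi r.
  move=> rrs; apply/eqP; rewrite -subr_eq0 -mulr_algl -mulrBl -horner_alg_XsubC -rmorphM /=.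
  rewrite /lagrange_poly -scalerAr -roots_poly_cons.
  have -> : roots_poly (r :: rem r rs) = roots_poly rs.
    by apply/esym/perm_big/perm_to_rem.
  by rewrite linearZ /= rs0 mulr0.
have pipi r : r \in rs -> pi r * pi r = pi r.
  move=> rrs; rewrite {1}/pi (horner_alg_eigen _ (xpi r rrs)).
  by rewrite lagrange_poly_self // scale1r.
have piC r y : x * y = y * x -> pi r * y = y * pi r by apply: horner_alg_intertwine.
have ppx p : p \in ps -> p * x = x * p.
  by move=> /psP[_ _ pC _]; apply: pC => y ys; apply: xsC; rewrite ?inE ?ys ?eqxx ?orbT.
exists [seq p * pi r | p <- ps, r <- rs].
  rewrite big_allpairs_dep /=; under eq_bigr do rewrite -mulr_sumr.
  by rewrite -mulr_suml ps1 mul1r -rmorph_sum /= sum_lagrange_poly // rmorph1.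
move=> _ /allpairsP[[p r] /= [pps rrs ->]]; have [pp Pp pC px] := psP p pps.
split.
- by rewrite mulrA -[X in X * pi r]mulrA (piC r p) ?ppx // !mulrA pp -mulrA pipi.
- by case: (cP) => _ _; apply=> //; apply: subalg_horner.
- move=> y yC; rewrite -mulrA piC ?yC ?mem_head // !mulrA pC // => z zs.
  by apply: yC; rewrite inE zs orbT.
- move=> y; rewrite inE => /predU1P[->|ys].
    by exists r; rewrite mulrA -ppx // -mulrA xpi // -scalerAr.
  by have [a ya] := px y ys; exists a; rewrite mulrA ya -scalerAl.
Qed.

End Diagonalizable.

(** * Lattices over the polynomial ring *)

Section Lattice.
Variables (F K : fieldType) (iota : {rmorphism {poly F} -> K}) (B : algType K).
Implicit Types (s : seq B) (u v x y : B).

(** The [F[q]]-submodule generated by [s]. The list may be linearly dependent; only the values of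
    [c] below [size s] enter. *)
Definition lat s v : Prop :=
  exists c : nat -> {poly F}, v = \sum_(i < size s) iota (c i) *: s`_i.

Definition carries s s' u : Prop := forall x, lat s x -> lat s' (x * u).

Lemma lat0 s : lat s 0.
Proof. by exists (fun=> 0); rewrite big1 // => i _; rewrite rmorph0 scale0r. Qed.

Lemma lat_lin s c u v : lat s u -> lat s v -> lat s (iota c *: u + v).
Proof.
move=> [a ->] [b ->]; exists (fun i => c * a i + b i).
rewrite scaler_sumr -big_split; apply: eq_bigr => i _ /=.
by rewrite scalerA -scalerDl rmorphD rmorphM.
Qed.

Lemma latD s u v : lat s u -> lat s v -> lat s (u + v).
Proof. by move=> /(@lat_lin s 1 u v) + sv; rewrite rmorph1 scale1r; apply. Qed.

Lemma latZ s c u : lat s u -> lat s (iota c *: u).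
Proof. by move=> su; rewrite -[_ *: _]addr0; apply: lat_lin => //; apply: lat0. Qed.

Lemma lat_mem s x : x \in s -> lat s x.
Proof.
move=> sx; exists (fun i => (i == index x s)%:R).
rewrite -index_mem in sx; rewrite (bigD1 (Ordinal sx)) //= eqxx rmorph1 scale1r.
rewrite nth_index -?index_mem // big1 ?addr0 // => i.
by rewrite -val_eqE /= => /negPf->; rewrite rmorph0 scale0r.
Qed.

Lemma lat_min s (P : B -> Prop) v : P 0 ->
  (forall c x y, P x -> P y -> P (iota c *: x + y)) ->
  (forall x, x \in s -> P x) -> lat s v -> P v.
Proof.
move=> P0 PD Ps [c ->]; elim/big_ind: _ => // [x y Px Py|i _].
  by have := PD 1 x y Px Py; rewrite rmorph1 scale1r.
by have := PD (c i) _ 0 (Ps _ (mem_nth 0 (ltn_ord i))) P0; rewrite addr0.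
Qed.

Lemma carriesW s s' u : (forall x, x \in s -> lat s' (x * u)) -> carries s s' u.
Proof.
move=> H x; apply: (lat_min (P := fun x => lat s' (x * u))) => [|c {}x y xu yu|//].
  by rewrite mul0r; apply: lat0.
by rewrite mulrDl -scalerAl; apply: lat_lin.
Qed.

Lemma carries1 s : carries s s 1.
Proof. by move=> x; rewrite mulr1. Qed.

Lemma carries0 s s' : carries s s' 0.
Proof. by move=> x _; rewrite mulr0; apply: lat0. Qed.

Lemma carriesD s s' u v : carries s s' u -> carries s s' v -> carries s s' (u + v).
Proof. by move=> cu cv x sx; rewrite mulrDr; apply: latD; [apply: cu|apply: cv]. Qed.

Lemma carriesZ s s' c u : carries s s' u -> carries s s' (iota c *: u).
Proof. by move=> cu x sx; rewrite -scalerAr; apply/latZ/cu. Qed.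

Lemma carriesM s s' s'' u v :
  carries s s' u -> carries s' s'' v -> carries s s'' (u * v).
Proof. by move=> cu cv x sx; rewrite mulrA; apply/cv/cu. Qed.

Lemma carriesX s u k : carries s s u -> carries s s (u ^+ k).
Proof.
move=> cu; elim: k => [|k IHk]; first by rewrite expr0; apply: carries1.
by rewrite exprS; apply: carriesM IHk.
Qed.

Lemma carries_sum s s' (I : eqType) (r : seq I) (E : I -> B) :
  (forall i, i \in r -> carries s s' (E i)) -> carries s s' (\sum_(i <- r) E i).
Proof.
move=> H; rewrite big_seq; elim/big_ind: _ => //; first exact: carries0.
exact: carriesD.
Qed.

Definition lat_prod s ys := [seq x * y | x <- s, y <- ys].

Lemma lat_prod1 s ys : lat s 1 -> 1 \in ys -> lat (lat_prod s ys) 1.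
Proof.
move=> s1 y1; rewrite -[1]mulr1; apply: (carriesW (s := s)) => // x sx.
by apply/lat_mem/allpairsP; exists (x, 1).
Qed.

Lemma carries_prod s ys y : y \in ys -> carries s (lat_prod s ys) y.
Proof. by move=> yy; apply: carriesW => x sx; apply/lat_mem/allpairsP; exists (x, y). Qed.

(** With [ys] in the role of coset representatives, it remains to rewrite each [y * u] as an element
    carrying the lattice of [s] followed by some member of [ys]. *)
Lemma stab_prod s ys u : (forall y, y \in ys -> carries s (lat_prod s ys) (y * u)) ->
  carries (lat_prod s ys) (lat_prod s ys) u.
Proof.
move=> H; apply: carriesW => _ /allpairsP[[x y] /= [sx yy ->]].
by rewrite -mulrA; apply: H => //; apply: lat_mem.
Qed.

(* Nakayama at [q = 1]: acting on the right of the lattice, [N + (q - 1) u] has a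
   matrix whose determinant takes the nonzero value [N ^ size s] at [q = 1]. *)
Lemma stab_linv s u (N : nat) : injective iota -> N%:R != 0 :> F -> lat s 1 ->
  carries s s u -> exists y, y * (N%:R + iota ('X - 1) *: u) = 1.
Proof.
move=> iota_inj N0 [k k1] su; set z := _ + _.
have /choice[A AE] (i : 'I_(size s)) : exists c : nat -> {poly F},
  s`_i * u = \sum_(l < size s) iota (c l) *: s`_l by apply/su/lat_mem/mem_nth.
pose M := (N%:R)%:M + ('X - 1) *: \matrix_(i < size s, l < size s) A i l.
have ME (i : 'I_(size s)) : s`_i * z = \sum_l iota (M i l) *: s`_l.
  rewrite /z mulrDr -scalerAr AE scaler_sumr.
  under [RHS]eq_bigr do rewrite !mxE rmorphD rmorphM /= scalerDl.
  rewrite big_split /=; congr (_ + _); last by apply: eq_bigr => l _; rewrite scalerA.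
  rewrite (bigD1 i) //= eqxx mulr1n rmorph_nat scaler_nat mulr_natr big1 ?addr0 //.
  by move=> l /negPf li; rewrite eq_sym li mulr0n rmorph0 scale0r.
have detM : iota (\det M) != 0.
  rewrite -(rmorph0 iota) inj_eq //; apply/eqP => /(congr1 (horner_eval 1)).
  rewrite -det_map_mx map_mxD map_scalar_mx map_mxZ /= rmorph0.
  rewrite rmorphB /= /horner_eval hornerX !hornerE subrr scale0r addr0 hornerMn hornerE.
  by rewrite det_scalar => /eqP; rewrite expf_eq0 (negPf N0) andbF.
(* Cramer's rule: the adjugate gives [det M] times each generator as a left multiple of [z]. Writing
   1 in the generators then yields a left inverse. *)
pose w (j : 'I_(size s)) := \sum_i iota (\adj M j i) *: s`_i.
have wz j : w j * z = iota (\det M) *: s`_j.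
  rewrite /w mulr_suml; under eq_bigr do rewrite -scalerAl ME scaler_sumr.
  rewrite exchange_big /=.
  transitivity (\sum_(l < size s) iota ((\adj M *m M) j l) *: s`_l).
    apply: eq_bigr => l _; rewrite mxE rmorph_sum scaler_suml /=.
    by apply: eq_bigr => i _; rewrite scalerA rmorphM.
  rewrite mul_adj_mx (bigD1 j) //= big1 ?addr0 => [|l /negPf lj].
    by rewrite mxE eqxx mulr1n.
  by rewrite mxE eq_sym lj mulr0n rmorph0 scale0r.
exists ((iota (\det M))^-1 *: \sum_(j < size s) iota (k j) *: w j).
rewrite -scalerAl mulr_suml; apply: (scalerI detM); rewrite scalerA divff // scale1r.
rewrite k1 scaler_sumr; apply: eq_bigr => j _.
by rewrite -scalerAl wz !scalerA mulrC.
Qed.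

End Lattice.

(** * Jucys-Murphy elements *)

Definition swap_nat (i j : nat) : nat :=
  if j == i then i.+1 else if j == i.+1 then i else j.

Lemma swap_natl i : swap_nat i i = i.+1.
Proof. by rewrite /swap_nat eqxx. Qed.

Lemma swap_natr i : swap_nat i i.+1 = i.
Proof. by rewrite /swap_nat eqxx; case: eqP => // /eqP; rewrite eqn_leq ltnn. Qed.

Lemma swap_natD i j : j != i -> j != i.+1 -> swap_nat i j = j.
Proof. by rewrite /swap_nat => /negPf-> /negPf->. Qed.

Lemma swap_natK i : involutive (swap_nat i).
Proof.
move=> j; have [->|ji] := eqVneq j i; first by rewrite swap_natl swap_natr.
have [->|jSi] := eqVneq j i.+1; first by rewrite swap_natr swap_natl.
by rewrite !swap_natD.
Qed.

Section YokonumaSystem.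
Variables (F K : fieldType) (iota : {rmorphism {poly F} -> K}) (B : algType K).
Variables (d n : nat) (g t : nat -> B).

Let q := iota 'X.

Definition idem_e i : B := iota (d%:R^-1)%:P *:
  \sum_(s < d) t i ^+ s * t i.+1 ^+ (d - s).

(* The generators are indexed by all of [nat]: beyond the range one takes [g i = 0]
   and [t j = 1], which breaks only the quadratic relation. *)
Record yh_system : Prop := YHSystem {
  yh_far : forall i j, (i.+1 < j)%N -> g i * g j = g j * g i;
  yh_bra : forall i, g i * g i.+1 * g i = g i.+1 * g i * g i.+1;
  yh_com : forall i j, t i * t j = t j * t i;
  yh_swp : forall i j, t j * g i = g i * t (swap_nat i j);
  yh_ord : forall j, t j ^+ d = 1;
  yh_quad : forall i, (i.+1 < n)%N ->
    g i * g i = q%:A + (q - 1) *: (idem_e i * g i);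
  yh_triv : forall j, (n <= j)%N -> t j = 1;
  yh_span : forall P : B -> Prop, subalg_closed_prop P -> (forall j, P (t j)) ->
    (forall i, (i.+1 < n)%N -> P (g i)) -> forall x, P x
}.

Definition alg m x : Prop := forall P : B -> Prop, subalg_closed_prop P ->
  (forall j, P (t j)) -> (forall i, (i.+1 < m)%N -> P (g i)) -> P x.

Fixpoint jm k : B := if k is k'.+1 then q^-1 *: (g k' * jm k' * g k') else 1.
Fixpoint twist m : B := if m is m'.+1 then twist m' * jm m' else 1.

Hypothesis H : yh_system.
Hypothesis iota_inj : injective iota.

Lemma q_neq0 : q != 0.
Proof. by rewrite -(rmorph0 iota) inj_eq // polyX_eq0. Qed.

Lemma q_neq1 : q - 1 != 0.
Proof.
rewrite -(rmorph1 iota) -rmorphB /= -(rmorph0 iota) inj_eq //.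
by rewrite -[1]polyC1 polyXsubC_eq0.
Qed.

Lemma alg_closed m : subalg_closed_prop (alg m).
Proof.
split=> [c|x y ax ay|x y ax ay] P cP Pt Pg; case: (cP) => PC PD PM.
- exact: PC.
- by apply: PD; [apply: ax|apply: ay].
- by apply: PM; [apply: ax|apply: ay].
Qed.

Lemma algD m x y : alg m x -> alg m y -> alg m (x + y).
Proof. by have [_ + _] := alg_closed m; apply. Qed.
Lemma algM m x y : alg m x -> alg m y -> alg m (x * y).
Proof. by have [_ _] := alg_closed m; apply. Qed.
Lemma algC m c : alg m c%:A.
Proof. by have [+ _ _] := alg_closed m; apply. Qed.
Lemma algZ m c x : alg m x -> alg m (c *: x).
Proof. by move=> ax; rewrite -mulr_algl; apply: algM => //; apply: algC. Qed.
Lemma alg1 m : alg m 1. Proof. by rewrite -[1]scale1r; apply: algC. Qed.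
Lemma alg0 m : alg m 0. Proof. by rewrite -[0](scale0r 1); apply: algC. Qed.
Lemma algX m x k : alg m x -> alg m (x ^+ k).
Proof.
move=> ax; elim: k => [|k IHk]; first by rewrite expr0; apply: alg1.
by rewrite exprS; apply: algM.
Qed.
Lemma alg_sum m (I : Type) (r : seq I) (E : I -> B) :
  (forall i, alg m (E i)) -> alg m (\sum_(i <- r) E i).
Proof. by move=> aE; elim/big_ind: _ => //; [apply: alg0|apply: algD]. Qed.
Lemma alg_t m j : alg m (t j). Proof. by move=> P _ Pt _; apply: Pt. Qed.
Lemma alg_g m i : (i.+1 < m)%N -> alg m (g i).
Proof. by move=> im P _ _; apply. Qed.
Lemma alg_mono m m' x : (m <= m')%N -> alg m x -> alg m' x.
Proof.
move=> mm' ax; refine (ax (alg m') (alg_closed m') (@alg_t m') _).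
by move=> i im; apply: alg_g; apply: leq_trans mm'.
Qed.
Lemma alg_all x : alg n x.
Proof. by move=> P cP Pt Pg; apply: (yh_span H). Qed.

Lemma alg_e m i : alg m (idem_e i).
Proof. by apply: algZ; apply: alg_sum => s; apply: algM; apply: algX; apply: alg_t. Qed.

Lemma comm_closed y : subalg_closed_prop (fun x : B => y * x = x * y).
Proof.
split=> [c|x z xy zy|x z xy zy]; first by rewrite mulr_algl mulr_algr.
  by rewrite mulrDl mulrDr xy zy.
by rewrite mulrA xy -!mulrA zy.
Qed.

Lemma alg_commutes m y x : (forall j, y * t j = t j * y) ->
  (forall i, (i.+1 < m)%N -> y * g i = g i * y) -> alg m x -> y * x = x * y.
Proof.
by move=> yt yg ax; apply: (ax (fun x : B => y * x = x * y)) => //; apply: comm_closed.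
Qed.

Lemma g_t i j : g i * t j = t (swap_nat i j) * g i.
Proof. by rewrite (yh_swp H) swap_natK. Qed.

Lemma alg0_comm x y : alg 0 x -> alg 0 y -> x * y = y * x.
Proof.
move=> ax; apply: alg_commutes => // j; symmetry.
by apply: (alg_commutes _ _ ax) => // k; apply: yh_com.
Qed.

Lemma alg0_e i : alg 0 (idem_e i). Proof. exact: alg_e. Qed.

Lemma expr_swap i x y k : g i * x = y * g i -> g i * x ^+ k = y ^+ k * g i.
Proof.
move=> xy; elim: k => [|k IHk]; first by rewrite !expr0 mulr1 mul1r.
by rewrite !exprS mulrA xy -mulrA IHk mulrA.
Qed.

(** Moving [g i] across swaps [t i] and [t i.+1], and the sum defining [e] is symmetric under this
    swap through [s -> d - s]. *)
Lemma g_idem_e i : g i * idem_e i = idem_e i * g i.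
Proof.
rewrite /idem_e -scalerAl -scalerAr; congr (_ *: _).
rewrite mulr_sumr mulr_suml.
case: d (yh_ord H) => [|d' td]; first by rewrite !big_ord0.
have gtE k l : g i * (t i ^+ k * t i.+1 ^+ l) = t i.+1 ^+ k * t i ^+ l * g i.
  rewrite mulrA (expr_swap k (g_t i i)) swap_natl -mulrA.
  by rewrite (expr_swap l (g_t i i.+1)) swap_natr mulrA.
have tC k l : t i ^+ k * t i.+1 ^+ l = t i.+1 ^+ l * t i ^+ k.
  by apply: alg0_comm; apply: algX; apply: alg_t.
(* The exponent [d - s] runs over 1..d and [s] over 0..d-1, so the term [s = 0], equal to 1, is
   split off before reversing the rest. *)
rewrite !big_ord_recl /= !subn0 !td; congr (_ + _).
  by rewrite !expr0 !mul1r mulr1.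
under eq_bigr do rewrite gtE -tC.
rewrite (reindex_inj rev_ord_inj) /=; apply: eq_bigr => s _.
congr (_ ^+ _ * _ ^+ _ * _); have := ltn_ord s; rewrite /= /bump; lia.
Qed.

Lemma jm_alg k : alg k.+1 (jm k).
Proof.
elim: k => [|k IHk] /=; first exact: alg1.
apply: algZ; apply: algM; last exact: alg_g.
by apply: algM; [apply: alg_g|apply: alg_mono IHk].
Qed.

Lemma t_jm j k : t j * jm k = jm k * t j.
Proof.
elim: k j => [|k IHk] j /=; first by rewrite mulr1 mul1r.
rewrite -scalerAl -scalerAr; congr (_ *: _); rewrite !mulrA (yh_swp H).
by rewrite -(mulrA (g k) (t _)) IHk mulrA -(mulrA _ (t _)) (yh_swp H) swap_natK mulrA.
Qed.

Lemma g_jm i k : (i.+1 < k)%N || (k < i)%N -> g i * jm k = jm k * g i.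
Proof.
(* Strong induction: the borderline case [k = i.+2] unfolds [jm] twice and falls back on [jm i],
   where two braid moves conclude. *)
elim: k {-2}k (leqnn k) i => [|k IHk] [|l] // lk i.
- by rewrite /= mulr1 mul1r.
- by rewrite /= mulr1 mul1r.
rewrite ltnS => /orP[il|li]; last first.
  rewrite /= -scalerAl -scalerAr; congr (_ *: _); rewrite !mulrA -(yh_far H) //.
  rewrite -(mulrA (g l) (g i)) IHk // ?(ltnW li) ?orbT // mulrA.
  by rewrite -(mulrA _ (g i)) -(yh_far H) // mulrA.
rewrite leq_eqVlt in il; case/predU1P: il => [il|il]; last first.
  rewrite /= -scalerAl -scalerAr; congr (_ *: _); rewrite !mulrA (yh_far H) //.
  by rewrite -(mulrA (g l) (g i)) IHk ?il // mulrA -(mulrA _ (g i)) (yh_far H) // mulrA.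
subst l; rewrite /= -scalerAl -scalerAr; congr (_ *: _).
rewrite -!(scalerAl, scalerAr); congr (_ *: _).
have gJ : g i.+1 * jm i = jm i * g i.+1 by apply: IHk; [rewrite -ltnS ltnW|rewrite leqnn orbT].
rewrite !mulrA (yh_bra H) -(mulrA _ (g i.+1) (jm i)) gJ -!mulrA.
by congr (_ * (_ * (_ * _))); rewrite !mulrA (yh_bra H).
Qed.

Lemma jm_comm m k y : (m <= k)%N -> alg m y -> jm k * y = y * jm k.
Proof.
move=> mk; apply: alg_commutes => [j|i im]; first by rewrite t_jm.
by rewrite g_jm // (leq_trans im mk).
Qed.

Lemma twistS m : twist m.+1 = twist m * jm m.
Proof. by []. Qed.

Lemma twist_alg m : alg m (twist m).
Proof.
elim: m => [|m IHm] /=; first exact: alg1.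
by apply: algM; [apply: alg_mono IHm|apply: jm_alg].
Qed.

Lemma g_twist_far i m : (m <= i)%N -> g i * twist m = twist m * g i.
Proof.
elim: m => [|m IHm] mi /=; first by rewrite mulr1 mul1r.
by rewrite mulrA IHm ?(ltnW mi) // -mulrA g_jm ?mi ?orbT // mulrA.
Qed.

Lemma t_twist j m : t j * twist m = twist m * t j.
Proof.
elim: m => [|m IHm] /=; first by rewrite mulr1 mul1r.
by rewrite mulrA IHm -mulrA t_jm mulrA.
Qed.

Lemma jm_next i : g i * jm i * g i = q *: jm i.+1.
Proof. by rewrite /= scalerA divff ?q_neq0 // scale1r. Qed.

Lemma jm_commS i : jm i * jm i.+1 = jm i.+1 * jm i.
Proof. by rewrite (jm_comm (leqnn _) (@jm_alg i)). Qed.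

(** Since [jm i] commutes with [g i * jm i * g i], which is [q *: jm i.+1], both sides times [q]
    equal the word [g J g J g]. *)
Lemma g_jm_pair i : g i * (jm i * jm i.+1) = jm i * jm i.+1 * g i.
Proof.
have JC := jm_commS i.
have E1 : q *: (jm i * jm i.+1) = jm i * (g i * jm i * g i).
  by rewrite jm_next scalerAr.
have E2 : q *: (jm i * jm i.+1) = g i * jm i * g i * jm i.
  by rewrite jm_next JC scalerAl.
by apply: (scalerI q_neq0); rewrite scalerAr E1 scalerAl E2 !mulrA.
Qed.

(** The last generator [g i] of [alg i.+2] commutes with [twist i] and with the product
    [jm i * jm i.+1]; the earlier ones commute with the last [jm] and are covered by induction. *)
Lemma twist_comm m y : alg m y -> twist m * y = y * twist m.
Proof.
apply: alg_commutes => [j|]; first by rewrite t_twist.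
elim: m => [|m IHm] i //; rewrite ltnS leq_eqVlt => /predU1P[<-|im]; rewrite twistS.
  rewrite twistS -(mulrA (twist i)) -(mulrA (twist i)) -g_jm_pair.
  by rewrite (mulrA (twist i)) (mulrA (g i)) g_twist_far.
by rewrite -mulrA -g_jm ?im // mulrA IHm // mulrA.
Qed.
End YokonumaSystem.

(** * Intertwiners *)

Section Intertwiner.
Variables (F K : fieldType) (iota : {rmorphism {poly F} -> K}) (B : algType K).
Variables (d n : nat) (g t : nat -> B).
Hypothesis H : yh_system iota d n g t.
Hypothesis iota_inj : injective iota.
Hypothesis d_neq0 : d%:R != 0 :> F.

Local Notation q := (iota 'X).
Local Notation J := (jm iota g).
Local Notation e := (idem_e iota d t).

(** By [jm_tau] and [jmS_tau] it exchanges [jm i] and [jm i.+1], hence permutes their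
    eigenvalues. *)
Definition tau i : B := g i * J i - J i * g i.

Variable i : nat.
Hypothesis i_lt : (i.+1 < n)%N.

(** [h] commutes with [g i] and all [jm k], and plays the role of the scalar [q - 1] of the ordinary
    Hecke algebra. *)
Let h := (q - 1) *: e i.

Let gg : g i * g i = q%:A + h * g i.
Proof. by rewrite (yh_quad H) // /h scalerAl. Qed.

Let gh : g i * h = h * g i.
Proof. by rewrite /h -scalerAr (g_idem_e H) scalerAl. Qed.

Let hJ k : h * J k = J k * h.
Proof. by rewrite (jm_comm H (leq0n k)) //; apply: algZ; apply: alg0_e. Qed.

Let JC : J i * J i.+1 = J i.+1 * J i.
Proof. exact: (jm_commS H). Qed.

Lemma g_jmS : g i * J i.+1 = J i * g i + h * J i.+1.
Proof.
apply: (scalerI (q_neq0 iota_inj)).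
rewrite scalerDr (scalerAr q (g i) (J i.+1)) (scalerAr q h (J i.+1)) -jm_next //.
by rewrite !mulrA gg !mulrDl mulr_algl -scalerAl.
Qed.

Lemma jmS_g : J i.+1 * g i = g i * J i + h * J i.+1.
Proof.
apply: (scalerI (q_neq0 iota_inj)).
rewrite scalerDr (scalerAl q (J i.+1)) (scalerAr q h (J i.+1)) -jm_next //.
rewrite -!mulrA gg !mulrDr mulr_algr -scalerAr; congr (_ + _).
by rewrite (mulrA (J i)) -hJ -(mulrA h) (mulrA (g i) h) gh -mulrA.
Qed.

Lemma tauE : tau i = g i * (J i - J i.+1) + h * J i.+1.
Proof. by rewrite /tau mulrBr g_jmS opprD addrA addrNK. Qed.

Lemma tauE' : tau i = J i.+1 * g i - g i * J i.+1.
Proof. by rewrite /tau g_jmS jmS_g opprD addrACA subrr addr0. Qed.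

Lemma jmS_tau : J i.+1 * tau i = tau i * J i.
Proof.
rewrite [in RHS]tauE' /tau mulrBr mulrBl mulrA; congr (_ - _).
by rewrite -[RHS]mulrA -JC (g_jm_pair H) // mulrA JC.
Qed.

Lemma jm_tau : J i * tau i = tau i * J i.+1.
Proof.
rewrite [in LHS]tauE' /tau mulrBr mulrBl mulrA; congr (_ - _).
  by rewrite -(g_jm_pair H) // mulrA.
by rewrite mulrA.
Qed.

(** Where [jm i] acts by [a], the right-hand side is [-q] times a monic quadratic in [jm i.+1]: its
    roots are [q * a] and [a / q] if [e] acts by 1, and [a] twice if [e] acts by 0. *)
Lemma tau_sqr :
  tau i * tau i = h * h * J i * J i.+1 - q *: ((J i - J i.+1) * (J i - J i.+1)).
Proof.
have tg : tau i * g i = q *: (J i.+1 - J i) - h * (J i * g i).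
  rewrite /tau mulrBl jm_next // -mulrA gg mulrDr mulr_algr opprD addrA scalerBr.
  by rewrite mulrA -hJ -mulrA.
have E : J i.+1 * (h * (J i * g i)) = h * (J i * g i) * J i + h * h * J i * J i.+1.
  rewrite (mulrA (J i.+1)) -hJ -(mulrA h (J i.+1)) (mulrA (J i.+1)) -JC -(mulrA (J i)).
  rewrite jmS_g !mulrDr -!mulrA; congr (_ + _ * _).
  by rewrite (mulrA (J i)) -hJ -mulrA.
rewrite {2}/tau mulrBr (mulrA _ (g i)) (mulrA _ (J i)) -jmS_tau -(mulrA (J i.+1)) tg.
rewrite mulrBl mulrBr E opprB addrA [_ - _ + (_ + _)]addrA addrNK.
rewrite [X in X - _]addrC -addrA; congr (_ + _).
rewrite -scalerAl -scalerAr -scalerBr -scalerN; congr (_ *: _).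
by rewrite !(mulrBl, mulrBr) JC !opprB; rewrite addrC.
Qed.

Lemma g_inj x : g i * x = 0 -> x = 0.
Proof.
move=> gx; apply: (scalerI (q_neq0 iota_inj)); rewrite scaler0.
have := congr1 (fun y => y * x) gg.
by rewrite mulrDl -!mulrA gx !mulr0 mulr_algl addr0 => <-.
Qed.

Lemma expr_eigen (x w : B) (a : K) k : x * w = a *: w -> x ^+ k * w = a ^+ k *: w.
Proof.
move=> xw; elim: k => [|k IHk]; first by rewrite !expr0 mul1r scale1r.
by rewrite exprSr -mulrA xw -scalerAr IHk scalerA -exprS.
Qed.

Lemma t_eigen_ord j w a : w != 0 -> t j * w = a *: w -> a ^+ d = 1.
Proof.
move=> w0 /(expr_eigen d); rewrite (yh_ord H) mul1r -{1}[w]scale1r => /eqP.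
by rewrite -subr_eq0 -scalerBl scaler_eq0 (negPf w0) orbF subr_eq0 => /eqP.
Qed.

(** [e] projects onto equal eigenvalues: for distinct roots of unity [a] and [b] the sum over [s] is
    geometric and vanishes. *)
Lemma idem_e_eigen w a b : w != 0 -> t i * w = a *: w -> t i.+1 * w = b *: w ->
  e i * w = (a == b)%:R *: w.
Proof.
move=> w0 ta tb; have a1 := t_eigen_ord w0 ta; have b1 := t_eigen_ord w0 tb.
rewrite /idem_e -scalerAl mulr_suml.
under eq_bigr do rewrite -mulrA (expr_eigen _ tb) -scalerAr (expr_eigen _ ta) scalerA.
rewrite -scaler_suml scalerA; congr (_ *: _).
have [<-|ab] := eqVneq a b.
  under eq_bigr => s _ do rewrite -exprD subnK 1?ltnW // a1.
  rewrite sumr_const card_ord -(rmorph_nat iota) -rmorphM -polyC_natr -polyCM.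
  by rewrite mulVf // rmorph1.
have := subrXX b a d; rewrite a1 b1 subrr => /esym/eqP.
rewrite mulf_eq0 subr_eq0 eq_sym (negPf ab) /= => /eqP S0.
(* The exponent [d - s] exceeds that of the geometric sum by one, whence the factor [b]. *)
have -> : \sum_(s < d) b ^+ (d - s) * a ^+ s =
    b * \sum_(s < d) b ^+ (d.-1 - s) * a ^+ s.
  rewrite mulr_sumr; apply: eq_bigr => s _; rewrite mulrA -exprS; congr (_ ^+ _ * _).
  by have := ltn_ord s; lia.
by rewrite S0 !mulr0.
Qed.

(* [tau ^ 2 * f (J') = tau * f (J) * tau = 0], and on [w] the square of [tau] is a
   quadratic polynomial in [J']. *)
Lemma jmS_killed f w a (b : bool) : horner_alg (J i) f = 0 -> J i * w = a *: w ->
  e i * w = b%:R *: w ->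
  horner_alg (J i.+1) (f * roots_poly [:: q * a; a / q; a; a]) * w = 0.
Proof.
move=> fJ Jw ew; have q0 := q_neq0 iota_inj.
pose v := horner_alg (J i.+1) f * w.
have Jv : J i * v = a *: v.
  rewrite /v mulrA -(horner_alg_intertwine f (esym JC)) -mulrA Jw.
  by rewrite -scalerAr.
have ev : h * v = ((q - 1) * b%:R) *: v.
  rewrite /v mulrA -(horner_alg_intertwine f (esym (hJ i.+1))) -mulrA /h -scalerAl ew.
  by rewrite scalerA -scalerAr.
have JvJ : J i * (J i.+1 * v) = a *: (J i.+1 * v).
  by rewrite mulrA JC -mulrA Jv -scalerAr.
have tv : tau i * v = 0.
  by rewrite /v mulrA -(horner_alg_intertwine f jm_tau) fJ !mul0r.
have hh : h * h * J i * J i.+1 * v = (((q - 1) * b%:R) ^+ 2 * a) *: (J i.+1 * v).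
  rewrite -!mulrA JvJ -!scalerAr (mulrA h (J _)) hJ -(mulrA _ h) ev -scalerAr -scalerAr.
  by rewrite (mulrA h (J _)) hJ -(mulrA _ h) ev -scalerAr !scalerA; congr (_ *: _); ring.
pose u := (J i.+1 - a%:A) * v.
have uE : (J i - J i.+1) * v = - u by rewrite /u !mulrBl Jv mulr_algl opprB.
have Ju : J i * u = a *: u.
  by rewrite /u mulrBl mulrBr JvJ mulr_algl -scalerAr Jv scalerBr.
have uuE : (J i - J i.+1) * ((J i - J i.+1) * v) = (J i.+1 - a%:A) * u.
  by rewrite uE mulrN mulrBl Ju opprB mulrBl mulr_algl.
have : tau i * tau i * v = 0 by rewrite -mulrA tv mulr0.
rewrite tau_sqr mulrBl hh -(scalerAl q) -(mulrA _ _ v) uuE => key.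
rewrite mulrC rmorphM /= -mulrA -/v.
have -> : roots_poly [:: q * a; a / q; a; a] =
    ('X - (q * a)%:P) * ('X - (a / q)%:P) * (('X - a%:P) * ('X - a%:P)).
  by rewrite /roots_poly !big_cons big_nil mulr1 !mulrA.
case: b ew ev hh key => _ _ _; last first.
  rewrite mulr0 expr0n /= mul0r scale0r sub0r => /eqP.
  rewrite oppr_eq0 scaler_eq0 (negPf q0) /= => /eqP key.
  rewrite rmorphM /= -mulrA.
  suff -> : horner_alg (J i.+1) (('X - a%:P) * ('X - a%:P)) * v = 0 by rewrite mulr0.
  by rewrite rmorphM /= horner_alg_XsubC -mulrA.
rewrite mulr1 => key; rewrite mulrC rmorphM /= -mulrA.
suff -> : horner_alg (J i.+1) (('X - (q * a)%:P) * ('X - (a / q)%:P)) * v = 0.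
  by rewrite mulr0.
have polyE : q%:P * (('X - (q * a)%:P) * ('X - (a / q)%:P)) =
    q%:P * (('X - a%:P) * ('X - a%:P)) - ((q - 1) ^+ 2 * a)%:P * 'X.
  by have : a = q * (a / q) by [rewrite mulrC divfK]; move: (a / q) => b ->; ring.
apply: (scalerI q0); rewrite scaler0 scalerAl -mulr_algl -(horner_algC (J i.+1)) -rmorphM /= polyE.
have hC c p : horner_alg (J i.+1) (c%:P * p) = c *: horner_alg (J i.+1) p.
  by rewrite rmorphM /= horner_algC mulr_algl.
rewrite rmorphB /= !hC rmorphM /= horner_algX horner_alg_XsubC mulrBl.
by rewrite -(scalerAl q) -(scalerAl (_ * a)) -(mulrA _ _ v) -/u -opprB key oppr0.
Qed.

(* Otherwise [g w] would span, together with [w], a nontrivial Jordan block of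
   [jm i.+1]. *)
Lemma jmS_neq w a : (forall c y, (J i.+1 - c%:A) * ((J i.+1 - c%:A) * y) = 0 ->
    (J i.+1 - c%:A) * y = 0) ->
  J i * w = a *: w -> J i.+1 * w = a *: w -> e i * w = w -> a *: w = 0.
Proof.
move=> red Jw J'w ew; have E : (J i.+1 - a%:A) * (g i * w) = ((q - 1) * a) *: w.
  rewrite mulrBl mulr_algl mulrA jmS_g mulrDl -mulrA Jw -scalerAr -mulrA J'w -scalerAr.
  by rewrite /h -scalerAl ew addrC addKr scalerA mulrC.
have /red : (J i.+1 - a%:A) * ((J i.+1 - a%:A) * (g i * w)) = 0.
  by rewrite E -scalerAr (mulrBl w) J'w mulr_algl subrr scaler0.
by rewrite E -scalerA => /eqP; rewrite scaler_eq0 (negPf (q_neq1 iota_inj)) => /eqP.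
Qed.

End Intertwiner.

(** * Averaging *)

Section Averaging.
Variables (F K : fieldType) (iota : {rmorphism {poly F} -> K}) (B : algType K).
Variables (d n : nat) (g t : nat -> B).
Hypothesis H : yh_system iota d n g t.
Hypothesis iota_inj : injective iota.
Hypothesis natF_neq0 : forall m, m.+1%:R != 0 :> F.
Hypothesis d_gt0 : (0 < d)%N.

Local Notation q := (iota 'X).
Local Notation e := (idem_e iota d t).

(** [gword k l] is [g_k ... g_(k+l-1)]. For [k + l = m.+1] these words lift the coset
    representatives of S_(m+1) in S_(m+2). *)
Fixpoint gword k l : B := if l is l'.+1 then g k * gword k.+1 l' else 1.
Fixpoint gword_rev k l : B := if l is l'.+1 then gword_rev k.+1 l' * g k else 1.

Lemma g_gword_far i k l : (i.+1 < k)%N -> g i * gword k l = gword k l * g i.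
Proof.
elim: l k => [|l IHl] k ik /=; first by rewrite mulr1 mul1r.
by rewrite mulrA (yh_far H) // -!mulrA IHl // ltnW.
Qed.

Lemma gword_rev_g_far i k l : (i.+1 < k)%N -> gword_rev k l * g i = g i * gword_rev k l.
Proof.
elim: l k => [|l IHl] k ik /=; first by rewrite mulr1 mul1r.
by rewrite -mulrA -(yh_far H) // mulrA IHl ?mulrA // ltnW.
Qed.

Lemma g_gword i k l : (k <= i)%N -> (i.+1 < k + l)%N ->
  g i.+1 * gword k l = gword k l * g i.
Proof.
elim: l k => [|l IHl] k ki; first by lia.
move=> il; have [ik|ik] := eqVneq i k; last first.
  have ki' : (k < i)%N by rewrite ltn_neqAle eq_sym ik.
  by rewrite /= mulrA -(yh_far H) // -!mulrA IHl //; lia.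
case: l IHl il => [|l] IHl; first by lia.
by rewrite ik => _ /=; rewrite !mulrA -(yh_bra H) -!mulrA g_gword_far.
Qed.

Lemma gword_rev_g i k l : (k <= i)%N -> (i.+1 < k + l)%N ->
  gword_rev k l * g i.+1 = g i * gword_rev k l.
Proof.
elim: l k => [|l IHl] k ki; first by lia.
move=> il; have [ik|ik] := eqVneq i k; last first.
  have ki' : (k < i)%N by rewrite ltn_neqAle eq_sym ik.
  by rewrite /= -mulrA (yh_far H) // mulrA IHl ?mulrA //; lia.
case: l IHl il => [|l] IHl; first by lia.
rewrite ik => _ /=; rewrite -!mulrA [g k.+1 * _]mulrA -(yh_bra H).
by rewrite !mulrA gword_rev_g_far.
Qed.

(** [j'] is the image of [j] under the permutation of the word; the same index serves the word and
    its reverse. *)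
Lemma t_gword k l j : exists j',
  t j * gword k l = gword k l * t j' /\ t j' * gword_rev k l = gword_rev k l * t j.
Proof.
elim: l k j => [|l IHl] k j /=; first by exists j; rewrite !mulr1 !mul1r.
have [j' [up' dn']] := IHl k.+1 (swap_nat k j); exists j'; split.
  by rewrite mulrA (yh_swp H) -mulrA up' mulrA.
by rewrite mulrA dn' -mulrA (yh_swp H) swap_natK mulrA.
Qed.

Definition commutes_with (f : B -> B) x := forall y, f (x * y) = x * f y.

Lemma commutes_with_closed f : linear f -> subalg_closed_prop (commutes_with f).
Proof.
move=> lf; pose f' : {linear B -> B} := HB.pack f (GRing.isLinear.Build K B B *:%R f lf).
have -> : f = f' by [].
split=> [c|x y fx fy|x y fx fy] z.
- by rewrite !mulr_algl linearZ.
- by rewrite !mulrDl linearD fx fy.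
- by rewrite -mulrA fx fy mulrA.
Qed.

Lemma commutes_with_alg m f x : linear f -> (forall j, commutes_with f (t j)) ->
  (forall i, (i.+1 < m)%N -> commutes_with f (g i)) -> alg g t m x -> commutes_with f x.
Proof.
by move=> lf ft fg ax; apply: (ax (commutes_with f)) => //; apply: commutes_with_closed.
Qed.

Lemma linear_sum_op (I : finType) (a b : I -> B) (c : I -> K) f : linear f ->
  linear (fun y => \sum_i c i *: (a i * f (b i * y))).
Proof.
move=> lf k x y; rewrite scaler_sumr -big_split; apply: eq_bigr => i _ /=.
rewrite mulrDr -scalerAr lf mulrDr scalerDr -scalerAr !scalerA.
by rewrite mulrC.
Qed.

(** * Averaging over the powers of the [t j] *)

Section Projection.
Variables (m : nat) (S : B -> Prop) (p : B -> B).
Hypotheses (S_lin : lin_closed S) (S_stab : forall x y, alg g t m.+1 x -> S y -> S (x * y)).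
Hypotheses (p_lin : linear p) (pS : forall y, S (p y)) (p_id : forall y, S y -> p y = y).

Lemma average_t k : exists f : B -> B, [/\ linear f, forall y, S (f y),
  forall j, (j < k)%N -> commutes_with f (t j) & forall y, S y -> f y = (d ^ k)%:R *: y].
Proof.
elim: k => [|k [f [lf fS fc fE]]].
  by exists p; split=> // y Sy; rewrite p_id // scale1r.
have tk j l : t k ^+ l * t j = t j * t k ^+ l.
  by apply: (alg0_comm H); [apply: algX|]; apply: alg_t.
(* The sum over [s] of [t_k^s f (t_k^-s y)]; the factor [1 *:] only gives it the shape of
   [linear_sum_op]. *)
exists (fun y => \sum_(s < d) 1 *: (t k ^+ s * f (t k ^+ (d - s) * y))).
split=> [|y|j jk y|y Sy].
- exact: linear_sum_op.
- apply: lin_closed_sum => // s _; rewrite scale1r.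
  by apply: S_stab => //; apply: algX; apply: alg_t.
- rewrite mulr_sumr; under eq_bigr do rewrite scale1r.
  under [RHS]eq_bigr do rewrite scale1r.
  rewrite ltnS leq_eqVlt in jk; case/predU1P: jk => [->|jk]; last first.
    by apply: eq_bigr => s _; rewrite mulrA tk -mulrA fc // mulrA tk mulrA.
  (* Multiplying by [t k] shifts the summands cyclically: the last one of one side meets the first
     of the other because [t k ^+ d = 1]. *)
  case: d d_gt0 (yh_ord H k) => // d' _ td.
  rewrite big_ord_recl [RHS]big_ord_recr /= !subn0 td mul1r expr0 mul1r.
  rewrite subSnn expr1 mulrA -exprS td mul1r addrC; congr (_ + _).
  apply: eq_bigr => s _; rewrite !mulrA -exprS -exprSr; congr (_ * f (_ ^+ _ * _)).
  by have := ltn_ord s; rewrite /bump /=; lia.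
- rewrite -[RHS]mulr_algl; under eq_bigr => s _.
    rewrite scale1r fE; last by apply: S_stab => //; apply: algX; apply: alg_t.
    rewrite -scalerAr mulrA -exprD subnKC 1?ltnW // (yh_ord H) mul1r; over.
  by rewrite sumr_const card_ord mulr_algl scaler_nat -mulrnA -expnSr scaler_nat.
Qed.

Lemma average_t_all : exists f : B -> B, [/\ linear f, forall y, S (f y),
  forall j, commutes_with f (t j) & forall y, S y -> f y = (d ^ n)%:R *: y].
Proof.
have [f [lf fS fc fE]] := average_t n; exists f; split=> // j.
have [nj|] := leqP n j; last exact: fc.
by rewrite (yh_triv H) // => y; rewrite !mul1r.
Qed.

End Projection.

(** * Averaging from [alg m.+1] to [alg m.+2] *)

Section Step.
Variables (m : nat) (f : B -> B).
Hypotheses (lf : linear f) (ft : forall j, commutes_with f (t j)).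
Hypotheses (fg : forall i, (i < m)%N -> commutes_with f (g i)) (m_lt : (m.+1 < n)%N).

Let U k := gword k (m.+1 - k).
Let D k := gword_rev k (m.+1 - k).
Let O k y := U k * f (D k * y).

Let O_alg0 k x y : alg g t 0 x -> x * O k y = O k (x * y).
Proof.
have lO : linear (O k).
  by move=> c u v; rewrite /O mulrDr -scalerAr lf mulrDr -scalerAr.
move=> ax; symmetry; move: y; apply: (commutes_with_alg lO _ _ ax) => // j y; rewrite /O.
have [j' [Uj Dj]] := t_gword k (m.+1 - k) j.
by rewrite mulrA /D -Dj -mulrA ft !mulrA -Uj.
Qed.

(** Passing through the word, [g i] stays itself if [i.+1 < k] and becomes [g i.-1] if [k < i];
    either way it lands where [f] commutes with it. *)
Let O_far i k y : (i <= m)%N -> (k <= m.+1)%N -> k != i -> k != i.+1 ->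
  g i * O k y = O k (g i * y).
Proof.
move=> im km ki kSi; have [ik|ki'] := ltnP i k.
  have {}ik : (i.+1 < k)%N by rewrite ltn_neqAle eq_sym kSi.
  rewrite /O mulrA g_gword_far // -mulrA -fg; last by lia.
  by rewrite !mulrA /D gword_rev_g_far.
case: i im ki kSi ki' => [|i] im ki _ ki'; first by lia.
rewrite /O mulrA /U g_gword; [|lia..]; rewrite -mulrA -fg; last by lia.
by rewrite !mulrA /D gword_rev_g //; lia.
Qed.

Let U_step i : (i <= m)%N -> U i = g i * U i.+1.
Proof. by move=> im; rewrite /U subSn // subSS. Qed.

Let D_step i : (i <= m)%N -> D i = D i.+1 * g i.
Proof. by move=> im; rewrite /D subSn // subSS. Qed.

(** After the quadratic relation, the cross terms coming from [k = i] and [k = i.+1] match exactly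
    because the second carries the weight [q]; the terms with [h] agree since [h] is a polynomial in
    the [t j]. *)
Let O_pair i y : (i <= m)%N ->
  g i * (O i y + q *: O i.+1 y) = O i (g i * y) + q *: O i.+1 (g i * y).
Proof.
move=> im; pose h := (q - 1) *: e i.
have gg : g i * g i = q%:A + h * g i by rewrite (yh_quad H) ?scalerAl //; lia.
have gg' : g i * g i = q%:A + g i * h.
  by rewrite gg /h -scalerAl -scalerAr (g_idem_e H).
have E1 : g i * O i y = q *: (U i.+1 * f (D i * y)) + O i (h * y).
  rewrite -O_alg0; last by apply: algZ; apply: alg0_e.
  by rewrite /O U_step // !mulrA gg mulrDl mulr_algl mulrDl -scalerAl -!mulrA.
have E2 : O i (g i * y) = q *: (U i * f (D i.+1 * y)) + O i (h * y).
  rewrite /O (mulrA (D i)) {1}D_step // -(mulrA (D i.+1)) gg' mulrDr mulr_algr mulrDl -scalerAl.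
  rewrite lf mulrDr -scalerAr; congr (_ + U i * f _).
  by rewrite !mulrA -D_step.
rewrite mulrDr E1 E2 -scalerAr /O !mulrA -U_step // -D_step //.
by rewrite addrAC addrC [RHS]addrAC addrC [X in _ = X + _]addrC; congr (_ + _).
Qed.

(** The last index [k = m.+1] is the empty word and contributes a multiple of [f] itself. *)
Definition average_g y := \sum_(k < m.+2) q ^+ k *: (U k * f (D k * y)).

Lemma average_g_linear : linear average_g.
Proof. exact: linear_sum_op. Qed.

Lemma average_g_t j : commutes_with average_g (t j).
Proof.
move=> y; rewrite /average_g mulr_sumr; apply: eq_bigr => k _.
by rewrite -scalerAr; congr (_ *: _); symmetry; apply: O_alg0; apply: alg_t.
Qed.

Lemma average_g_g i : (i < m.+1)%N -> commutes_with average_g (g i).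
Proof.
rewrite ltnS => im y; apply/esym; rewrite /average_g mulr_sumr.
have i1 : (i < m.+2)%N by lia.
have i2 : (i.+1 < m.+2)%N by lia.
rewrite (bigD1 (Ordinal i1)) // [RHS](bigD1 (Ordinal i1)) //=.
rewrite (bigD1 (Ordinal i2)) /=; last by rewrite -val_eqE /=; lia.
rewrite [in RHS](bigD1 (Ordinal i2)) /=; last by rewrite -val_eqE /=; lia.
rewrite !addrA; congr (_ + _); last first.
  apply: eq_bigr => k; rewrite -!val_eqE /= => /andP[ki kSi].
  by rewrite -scalerAr; congr (_ *: _); apply: O_far; rewrite // -ltnS.
rewrite exprSr -!scalerA -!scalerAr -!scalerDr; congr (_ *: _).
by rewrite (scalerAr q (g i)) -mulrDr; apply: O_pair.
Qed.

End Step.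

Fixpoint casimir m : B :=
  if m is m'.+1 then \sum_(k < m'.+2)
    q ^+ k *: (gword k (m'.+1 - k) * casimir m' * gword_rev k (m'.+1 - k))
  else (d ^ n)%:R.

Lemma gword_alg m k l : (k + l <= m)%N ->
  alg g t m.+1 (gword k l) /\ alg g t m.+1 (gword_rev k l).
Proof.
elim: l k => [|l IHl] k klm /=; first by split; apply: alg1.
have [|au ad] := IHl k.+1; first by lia.
by split; apply: algM => //; apply: alg_g; lia.
Qed.

Lemma maschke m (S : B -> Prop) p : (m < n)%N -> lin_closed S ->
  (forall x y, alg g t m.+1 x -> S y -> S (x * y)) ->
  linear p -> (forall y, S (p y)) -> (forall y, S y -> p y = y) ->
  exists f : B -> B, [/\ linear f, forall y, S (f y),
    forall x, alg g t m.+1 x -> commutes_with f x & forall y, S y -> f y = casimir m * y].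
Proof.
move=> + S_lin + lp pS p_id; elim: m => [|m IHm] mn S_stab.
  have [f [lf fS ft fE]] := average_t_all S_lin S_stab lp pS p_id.
  exists f; split=> [//|//|x ax|y Sy]; first exact: (commutes_with_alg lf ft _ ax).
  by rewrite fE // mulr_natl scaler_nat.
have [|x y ax Sy|f [lf fS fc fE]] := IHm; first exact: ltnW.
  by exact: S_stab (alg_mono _ ax) Sy.
have ft j : commutes_with f (t j) by apply: fc; apply: alg_t.
have fg i : (i < m)%N -> commutes_with f (g i) by move=> im; apply: fc; apply: alg_g.
have UD (k : 'I_m.+2) := @gword_alg m.+1 k (m.+1 - k) ltac:(have := ltn_ord k; lia).
exists (average_g m f); split=> [|y|x|y Sy].
- exact: average_g_linear.
- apply: lin_closed_sum => // k _; apply: lin_closedZ => //; apply: S_stab => //.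
  by have [] := UD k.
- move=> ax; apply: (commutes_with_alg (average_g_linear m lf) _ _ ax) => [j|i].
    exact: average_g_t.
  by rewrite ltnS => im; apply: average_g_g.
- rewrite /= mulr_suml; apply: eq_bigr => k _; have [aU aD] := UD k.
  by rewrite fE ?mulrA ?scalerAl //; apply: S_stab.
Qed.

(** * The averaging element at [q = 1] *)

Section Stabilizer.
Variable s : seq B.
Hypotheses (st : forall j, carries iota s s (t j)).
Hypotheses (sg : forall i, (i.+1 < n)%N -> carries iota s s (g i)).

(** Congruence modulo [q - 1] in the ring of elements that stabilize the lattice. *)
Definition cong1 a b : Prop :=
  exists2 x, carries iota s s x & a = b + iota ('X - 1) *: x.

Lemma cong1_refl a : cong1 a a.
Proof. by exists 0; [apply: carries0|rewrite scaler0 addr0]. Qed.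

Lemma cong1D a b a' b' : cong1 a b -> cong1 a' b' -> cong1 (a + a') (b + b').
Proof.
move=> [x sx ->] [x' sx' ->]; exists (x + x'); first exact: carriesD.
by rewrite scalerDr addrACA.
Qed.

Lemma cong1M a b a' b' : carries iota s s b -> carries iota s s b' ->
  cong1 a b -> cong1 a' b' -> cong1 (a * a') (b * b').
Proof.
move=> sb sb' [x sx ->] [x' sx' ->].
exists (b * x' + x * (b' + iota ('X - 1) *: x')).
  apply: carriesD; first exact: carriesM sx'.
  by apply: carriesM sx _; apply: carriesD => //; apply: carriesZ.
by rewrite mulrDl mulrDr -addrA scalerDr -scalerAr -scalerAl.
Qed.

Lemma cong1_trans a b c : cong1 a b -> cong1 b c -> cong1 a c.
Proof.
move=> [x sx ->] [y sy ->]; exists (y + x); first exact: carriesD.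
by rewrite scalerDr addrA.
Qed.

Lemma cong1_qX k x : carries iota s s x -> cong1 (q ^+ k *: x) x.
Proof.
move=> sx; elim: k => [|k IHk]; first by rewrite scale1r; apply: cong1_refl.
apply: cong1_trans IHk; exists (iota ('X^k) *: x); first exact: carriesZ.
by rewrite scalerA rmorphB rmorph1 rmorphXn /= mulrBl mul1r -exprS scalerBl addrC subrK.
Qed.

Lemma carries_e i : carries iota s s (e i).
Proof.
apply: carriesZ; apply: carries_sum => k _.
by apply: carriesM; apply: carriesX.
Qed.

Lemma cong1_gg i : (i.+1 < n)%N -> cong1 (g i * g i) 1.
Proof.
move=> i_lt; exists (1 + e i * g i).
  by apply: carriesD; [apply: carries1|apply: carriesM (carries_e i) (sg i_lt)].
rewrite (yh_quad H) // scalerDr addrA rmorphB rmorph1; congr (_ + _).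
by rewrite scalerBl scale1r addrC subrK.
Qed.

Lemma carries_gword k l : (k + l < n)%N ->
  [/\ carries iota s s (gword k l), carries iota s s (gword_rev k l)
    & cong1 (gword k l * gword_rev k l) 1].
Proof.
elim: l k => [|l IHl] k kln /=.
  by rewrite mulr1; split; [exact: carries1|exact: carries1|exact: cong1_refl].
have [|su sd c1] := IHl k.+1; first by lia.
have gk : carries iota s s (g k) by apply: sg; lia.
split; [exact: carriesM su|exact: carriesM gk|].
rewrite mulrA -(mulrA (g k)).
apply: (@cong1_trans _ (g k * 1 * g k)); last by rewrite mulr1; apply: cong1_gg; lia.
apply: cong1M (cong1_refl _) => //; first by rewrite mulr1.
by apply: cong1M (cong1_refl _) _ => //; apply: carries1.
Qed.

(** At [q = 1] every [g i] squares to 1, so each word cancels its reverse and [casimir m.+1] becomes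
    [m.+2] times [casimir m]. The integer is thus [d ^ n * (m.+1)!]. *)
Lemma casimir_cong1 m : (m < n)%N -> exists2 N, (0 < N)%N & cong1 (casimir m) N%:R.
Proof.
elim: m => [|m IHm] mn; first by exists (d ^ n)%N; rewrite ?expn_gt0 ?d_gt0 //; apply: cong1_refl.
have [|N N0 cN] := IHm; first exact: ltnW.
exists (m.+2 * N)%N; first by rewrite muln_gt0.
rewrite natrM mulr_natl -[X in _ *+ X]card_ord -sumr_const /=.
have sN a : carries iota s s a%:R.
  elim: a => [|a IHa]; first exact: carries0.
  by rewrite -addn1 natrD; apply: carriesD => //; apply: carries1.
have sz : carries iota s s (casimir m).
  by have [x sx ->] := cN; apply: carriesD => //; apply: carriesZ.
elim/big_ind2: _ => [||k _]; [exact: cong1_refl|by move=> *; apply: cong1D|].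
have [|su sd c1] := @carries_gword k (m.+1 - k); first by have := ltn_ord k; lia.
apply: cong1_trans (cong1_qX k (carriesM (carriesM su sz) sd)) _.
(* The middle factor is replaced by the scalar [N] first; only then do the two words become
   adjacent. *)
apply: (@cong1_trans _ (gword k (m.+1 - k) * N%:R * gword_rev k (m.+1 - k))).
  apply: cong1M (cong1_refl _) => //; first exact: carriesM (sN N).
  by apply: cong1M cN => //; apply: cong1_refl.
rewrite mulr_natr mulrnAl -mulr_natl -[X in cong1 _ X]mulr1.
by apply: cong1M c1; [|exact: carries1|exact: cong1_refl].
Qed.

End Stabilizer.

(** * Construction of a lattice stable under the generators *)

Lemma t_lattice k : exists s : seq B, lat iota s 1 /\
  forall j, (j < k)%N -> carries iota s s (t j).
Proof.
elim: k => [|k [s [s1 sj]]].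
  by exists [:: 1]; split=> //; apply: lat_mem; rewrite mem_head.
pose ys := [seq t k ^+ a | a <- seq.iota 0 d].
have ysX a : (a < d)%N -> t k ^+ a \in ys.
  by move=> ad; apply/mapP; exists a => //; rewrite mem_iota.
exists (lat_prod s ys); split=> [|j jk].
  by apply: lat_prod1 => //; rewrite -(expr0 (t k)) ysX.
apply: stab_prod => _ /mapP[a + ->]; rewrite mem_iota /= add0n => ad.
rewrite ltnS leq_eqVlt in jk; case/predU1P: jk => [->|jk].
  rewrite -exprSr; move: ad; rewrite leq_eqVlt => /predU1P[->|ad].
    by rewrite (yh_ord H); apply: carries_prod; rewrite -(expr0 (t k)) ysX.
  by apply: carries_prod; apply: ysX.
have -> : t k ^+ a * t j = t j * t k ^+ a.
  by apply: (alg0_comm H); [apply: algX|]; apply: alg_t.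
by apply: carriesM (sj _ jk) _; apply: carries_prod; apply: ysX.
Qed.

(** One step of the tower multiplies the lattice by the reversed words [D k]. Right multiplication
    of [D k] by [g i] gives [g i.-1 * D k], a use of the quadratic relation, [D i], or [g i * D k],
    according as [k < i], [k = i], [k = i.+1] or [k > i.+1]. *)
Lemma lattice m : (m < n)%N -> exists s : seq B, [/\ lat iota s 1,
  forall j, carries iota s s (t j) & forall i, (i < m)%N -> carries iota s s (g i)].
Proof.
elim: m => [|m IHm] mn.
  have [s [s1 sj]] := t_lattice n; exists s; split=> // j.
  have [nj|] := leqP n j; last exact: sj.
  by rewrite (yh_triv H) //; apply: carries1.
have [|s [s1 st sg]] := IHm; first exact: ltnW.
pose D k := gword_rev k (m.+1 - k); pose ys := [seq D k | k <- seq.iota 0 m.+2].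
have ysD k : (k <= m.+1)%N -> D k \in ys.
  by move=> km; apply/mapP; exists k => //; rewrite mem_iota.
have sD k : (k <= m.+1)%N -> carries iota s (lat_prod s ys) (D k).
  by move=> km; apply/carries_prod/ysD.
have D_step i : (i <= m)%N -> D i = D i.+1 * g i.
  by move=> im; rewrite /D subSn // subSS.
have sDt k j : (k <= m.+1)%N -> exists j', t j' * D k = D k * t j.
  by move=> _; have [j' [_ E]] := t_gword k (m.+1 - k) j; exists j'.
exists (lat_prod s ys); split=> [|j|i im].
- by apply: lat_prod1 => //; rewrite -[1]/(gword_rev m.+1 0) -(subnn m.+1) ysD.
- apply: stab_prod => _ /mapP[k + ->]; rewrite mem_iota /= add0n ltnS => km.
  by have [j' <-] := sDt k j km; apply: carriesM (st j') (sD _ km).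
apply: stab_prod => _ /mapP[k + ->]; rewrite mem_iota /= add0n ltnS => km.
have [ki|] := ltnP k i.
  case: i im ki => // i im ki; rewrite /D gword_rev_g; [|lia..].
  by apply: carriesM (sD _ km); apply: sg; lia.
rewrite leq_eqVlt => /predU1P[<-|ik]; last first.
  move: ik; rewrite leq_eqVlt => /predU1P[ik|ik].
    by rewrite -ik -D_step //; apply: sD; lia.
  by rewrite /D gword_rev_g_far //; apply: carriesM (sD _ km); apply: sg; lia.
rewrite [D i]D_step // -mulrA.
have -> : D i.+1 * (g i * g i) = iota 'X *: D i.+1 + iota ('X - 1) *: (D i * e i).
  rewrite (yh_quad H) -?(g_idem_e H); last by lia.
  by rewrite mulrDr mulr_algr -scalerAr mulrA -D_step // rmorphB rmorph1.
apply: carriesD; apply: carriesZ; first by apply: sD.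
rewrite /idem_e -scalerAr mulr_sumr; apply: carriesZ; apply: carries_sum => a _.
(* In the remaining term [D i * e i] the powers of [t] are moved to the left of [D i], where they
   stabilize the lattice of [s]. *)
have DtX j b : exists2 x, carries iota s s x & D i * t j ^+ b = x * D i.
  have [|j' E] := sDt i j; first by lia.
  exists (t j' ^+ b); first exact: carriesX.
  elim: b => [|b IHb]; first by rewrite !expr0 mulr1 mul1r.
  by rewrite exprS mulrA -E -mulrA IHb mulrA -exprS.
have [x sx xE] := DtX i a; have [y sy yE] := DtX i.+1 (d - a)%N.
rewrite mulrA xE -mulrA yE; apply: carriesM sx _; apply: carriesM sy _.
by apply: sD; lia.
Qed.

Lemma charF_neq0 N : (0 < N)%N -> N%:R != 0 :> F.
Proof. by case: N. Qed.

Hypothesis n_gt0 : (0 < n)%N.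

Lemma full_lattice : exists s : seq B, [/\ lat iota s 1,
  forall j, carries iota s s (t j) & forall i, (i.+1 < n)%N -> carries iota s s (g i)].
Proof.
have [|s [s1 st sg]] := @lattice n.-1; first by rewrite prednK.
by exists s; split=> // i i_lt; apply: sg; lia.
Qed.

Lemma casimir_linv m : (m < n)%N -> exists y, y * casimir m = 1.
Proof.
move=> mn; have [s [s1 st sg]] := full_lattice.
have [N N0 [x sx ->]] := casimir_cong1 st sg mn.
exact: (stab_linv iota_inj (charF_neq0 N0) s1 sx).
Qed.

(** The [K]-span of a lattice containing 1 and stable under right multiplication by the generators
    is a right ideal containing 1. *)
Lemma fin_span : exists s : seq B, forall v, lin_span s v.
Proof.
have [s [s1 st sg]] := full_lattice; exists s => v.
have ls u : lat iota s u -> lin_span s u.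
  move=> su S [S0 SD] Ss; apply: lat_min su => // c x y; apply: SD.
suff sv : forall x, lin_span s x -> lin_span s (x * v) by rewrite -[v]mul1r; apply: sv; apply: ls.
have W b : carries iota s s b -> forall x, lin_span s x -> lin_span s (x * b).
  move=> sb x sx S cS Ss; apply: (sx (fun x => S (x * b))).
    case: cS => S0 SD; split; first by rewrite mul0r.
    by move=> c y z Sy Sz; rewrite mulrDl -scalerAl; apply: SD.
  by move=> y ys; apply: ls => //; apply: sb; apply: lat_mem.
apply: (yh_span H (P := fun v => forall x, lin_span s x -> lin_span s (x * v))).
- split=> [c|y z sy sz|y z sy sz] x sx.
  + by rewrite mulr_algr => S cS Ss; apply: lin_closedZ => //; apply: sx.
  + rewrite mulrDr => S cS Ss; apply: lin_closedD => //; [exact: sy|exact: sz].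
  + by rewrite mulrA; apply: sz; apply: sy.
- by move=> j; apply: W.
- by move=> i i_lt; apply: W; apply: sg.
Qed.

Lemma maschke_projection m (S : B -> Prop) : (m < n)%N -> lin_closed S ->
  (forall x y, alg g t m.+1 x -> S y -> S (x * y)) ->
  exists f : B -> B, [/\ linear f, forall y, S (f y),
    forall x, alg g t m.+1 x -> commutes_with f x & forall y, S y -> f y = casimir m * y].
Proof.
move=> mn S_lin S_stab; have [s sB] := fin_span.
have [p [lp pS p_id]] := lin_projection S_lin sB.
exact: (maschke mn S_lin S_stab lp pS p_id).
Qed.

End Averaging.

(** * Weights *)

Section Weights.
Variables (F K : fieldType) (iota : {rmorphism {poly F} -> K}) (B : algType K).
Variables (d n : nat) (g t : nat -> B).
Hypothesis H : yh_system iota d n g t.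
Hypothesis iota_inj : injective iota.
Hypothesis natF_neq0 : forall m, m.+1%:R != 0 :> F.
Hypothesis d_gt0 : (0 < d)%N.
Hypothesis n_gt0 : (0 < n)%N.
Hypothesis unity_roots : exists2 rs : seq K, uniq rs & 'X^d - 1 = roots_poly rs.

Local Notation q := (iota 'X).
Local Notation J := (jm iota g).
Local Notation L := (twist iota g).
Local Notation e := (idem_e iota d t).
Local Notation alg := (alg g t).

Let d_neq0 : d%:R != 0 :> F. Proof. by case: d d_gt0. Qed.

Lemma twist_reduced m c y : (m < n)%N ->
  (L m.+1 - c%:A) * ((L m.+1 - c%:A) * y) = 0 -> (L m.+1 - c%:A) * y = 0.
Proof.
move=> mn; set N := L m.+1 - c%:A; set w := N * y => Nw.
have aN : alg m.+1 N.
  by rewrite /N -scaleNr; apply: algD; [exact: twist_alg|exact: algC].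
have NC x : alg m.+1 x -> N * x = x * N.
  by move=> ax; rewrite /N mulrBl mulrBr (twist_comm H iota_inj ax) mulr_algl mulr_algr.
have [||f [lf fN fC fE]] := maschke_projection H d_gt0 n_gt0
    (S := fun y => N * y = 0) mn.
- split; first by rewrite mulr0.
  by move=> a u v Nu Nv; rewrite mulrDr -scalerAr Nu Nv scaler0 addr0.
- by move=> x z ax Nz; rewrite mulrA NC // -mulrA Nz mulr0.
have [z zc] := casimir_linv H iota_inj natF_neq0 d_gt0 n_gt0 mn.
(* [casimir m * w] equals [f w] as [w] lies in the kernel, while [f (N * y) = N * f y] vanishes. *)
by rewrite -[w]mul1r -zc -mulrA -(fE w Nw) /w fC // fN mulr0.
Qed.

Lemma jm_inj k x : (k < n)%N -> J k * x = 0 -> x = 0.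
Proof.
elim: k x => [|k IHk] x kn; first by rewrite mul1r.
have kn' := ltnW kn.
rewrite /= -(scalerAl q^-1) => /eqP; rewrite scaler_eq0 invr_eq0 (negPf (q_neq0 iota_inj)).
rewrite /= -!mulrA => /eqP/(g_inj H iota_inj kn)/(IHk _ kn')/(g_inj H iota_inj kn).
exact.
Qed.

Lemma twist_inj m x : (m <= n)%N -> L m * x = 0 -> x = 0.
Proof.
elim: m x => [|m IHm] x mn; first by rewrite mul1r.
rewrite twistS -mulrA => Lx; apply: (jm_inj mn).
by apply: IHm Lx; apply: ltnW.
Qed.

Lemma twist_jmC m : L m * J m = J m * L m.
Proof. by rewrite (jm_comm H (leqnn m)) //; apply: twist_alg. Qed.

Lemma jm_eigen m w l l' : (m <= n)%N -> w != 0 -> L m * w = l *: w ->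
  L m.+1 * w = l' *: w -> l != 0 /\ J m * w = (l' / l) *: w.
Proof.
move=> mn w0 Lw L'w; have l0 : l != 0.
  by apply: contra_neq w0 => l0; apply: (twist_inj mn); rewrite Lw l0 scale0r.
split=> //; apply: (scalerI l0); rewrite scalerA mulrC divfK // -L'w.
by rewrite twistS twist_jmC -mulrA Lw -scalerAr.
Qed.

Lemma split_by_parts x (ps : seq B) : \sum_(p <- ps) p = 1 ->
  (forall p, p \in ps -> exists rs, horner_alg x (roots_poly rs) * p = 0) ->
  split_elt x.
Proof.
move=> ps1 psP; suff [rs rsP] : exists rs, forall p, p \in ps ->
    horner_alg x (roots_poly rs) * p = 0.
  by exists rs; rewrite -[LHS]mulr1 -ps1 mulr_sumr big_seq big1.
elim: ps psP {ps1} => [|p ps IHps] psP; first by exists [::].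
have [|rs rsP] := IHps; first by move=> p' ps'; apply: psP; rewrite inE ps' orbT.
have [rs' rs'p] := psP p (mem_head _ _).
have catE rs1 rs2 : roots_poly (rs1 ++ rs2) = roots_poly rs1 * roots_poly rs2 :> {poly K}.
  by rewrite /roots_poly big_cat.
exists (rs' ++ rs) => p'; rewrite inE catE => /predU1P[->|/rsP E].
  by rewrite mulrC rmorphM /= -mulrA rs'p mulr0.
by rewrite rmorphM /= -mulrA E mulr0.
Qed.

(** On vectors where [x] acts by [l], the product [x * y] acts as [l *: y], so roots for [y] are
    scaled by [l]. *)
Lemma split_scaled (x y w : B) l rs : x * y = y * x -> x * w = l *: w ->
  horner_alg y (roots_poly rs) * w = 0 ->
  horner_alg (x * y) (roots_poly [seq l * r | r <- rs]) * w = 0.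
Proof.
move=> xy; elim: rs w => [|r rs IHrs] w xw.
  by rewrite /roots_poly !big_nil !rmorph1.
rewrite [map _ _]/= !horner_roots_cons -!(mulrA (horner_alg _ _)) => rs0.
have -> : (x * y - (l * r)%:A) * w = l *: ((y - r%:A) * w).
  by rewrite !mulrBl xy -mulrA xw -scalerAr !mulr_algl scalerBr scalerA.
rewrite -scalerAr IHrs ?scaler0 //.
by rewrite mulrA mulrBr xy mulr_algr mulrBl -mulrA xw -scalerAl xw -scalerAr mulrBl
  mulr_algl scalerBr (scalerA r) mulrC -scalerA.
Qed.

Lemma t_diag j : diag_elt (t j).
Proof.
have [rs urs rsE] := unity_roots; exists rs => //.
by rewrite -rsE rmorphB rmorphXn rmorph1 /= horner_algX (yh_ord H) subrr.
Qed.

(** Weights record the eigenvalues of the central [twist k]; those of [jm k] are recovered as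
    quotients by [jm_eigen]. *)
Definition lwt m (chi : nat -> K) (om : nat -> K) w : Prop :=
  (forall j, t j * w = chi j *: w) /\ (forall k, (k <= m)%N -> L k * w = om k *: w).

Definition rwt m (chi : nat -> K) (om : nat -> K) w : Prop :=
  (forall j, w * t j = chi j *: w) /\ (forall k, (k <= m)%N -> w * L k = om k *: w).

Lemma twist_twistC k l : L k * L l = L l * L k.
Proof.
wlog kl : k l / (k <= l)%N by move=> W; case: (leqP k l) => [|/ltnW] kl; [|symmetry]; apply: W.
by rewrite (twist_comm H iota_inj (m := l)) //; apply: alg_mono kl _; apply: twist_alg.
Qed.

Lemma weight_idempotents m : (forall k, (k <= m)%N -> diag_elt (L k)) ->
  exists2 ps : seq B, \sum_(p <- ps) p = 1 & forall p, p \in ps ->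
   [/\ p * p = p, alg m p,
       forall y, (forall j, t j * y = y * t j) ->
         (forall k, (k <= m)%N -> L k * y = y * L k) -> p * y = y * p
     & exists chi om, lwt m chi om p].
Proof.
move=> Ld; pose xs := [seq t j | j <- seq.iota 0 n] ++ [seq L k | k <- seq.iota 0 m.+1].
have tt j k : t j * t k = t k * t j by apply: (yh_com H).
have xs_t j : (j < n)%N -> t j \in xs.
  by move=> jn; rewrite mem_cat (map_f t) // mem_iota.
have xs_L k : (k <= m)%N -> L k \in xs.
  by move=> km; rewrite mem_cat (map_f L) ?orbT // mem_iota.
have xsP x : x \in xs -> (exists j, x = t j) \/ (exists2 k, (k <= m)%N & x = L k).
  rewrite mem_cat => /orP[] /mapP[k]; rewrite mem_iota /= => km ->; first by left; exists k.
  by right; exists k.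
have [||ps ps1 psP] := @simul_diag _ _ (alg m) xs (alg_closed _ _ _).
- move=> x /xsP[[j ->]|[k km ->]]; first by split; [exact: t_diag|exact: alg_t].
  by split; [exact: Ld|apply: alg_mono km _; apply: twist_alg].
- move=> x y /xsP[[j ->]|[k km ->]] /xsP[[j' ->]|[k' km' ->]] //.
  + exact: (t_twist H).
  + exact/esym/(t_twist H).
  + exact: twist_twistC.
exists ps => // p /psP[pp ap pC px]; split=> // [y yt yL|].
  by apply: pC => x /xsP[[j ->]|[k km ->]]; [exact: yt|exact: yL].
have /choice[chi chiP] j : exists a, t j * p = a *: p.
  have [nj|jn] := leqP n j; last exact: px (xs_t _ jn).
  by exists 1; rewrite (yh_triv H) // mul1r scale1r.
have /choice[om omP] k : exists a, (k <= m)%N -> L k * p = a *: p.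
  case: (leqP k m) => [km|_]; last by exists 0.
  by have [a aE] := px _ (xs_L _ km); exists a.
by exists chi, om.
Qed.

Lemma jm_weight m p : (m < n)%N -> (exists chi om, lwt m.+1 chi om p) ->
  exists a, J m * p = a *: p.
Proof.
move=> mn [chi [om [_ omP]]]; have [->|p0] := eqVneq p 0.
  by exists 0; rewrite mulr0 scaler0.
have [_ E] := jm_eigen (ltnW mn) p0 (omP m (leqnSn m)) (omP m.+1 (leqnn _)).
by exists (om m.+1 / om m).
Qed.

(** Weight idempotents one level down make the last known [jm] split; [jmS_killed] transfers this to
    the next [jm], and [split_scaled] to the next [twist]. Repeated roots are removed by
    [twist_reduced]. *)
Lemma twist_diag m : (m <= n)%N -> forall k, (k <= m)%N -> diag_elt (L k).
Proof.
have diag1 : diag_elt (1 : B).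
  exists [:: 1] => //; rewrite /roots_poly big_seq1 horner_alg_XsubC.
  by rewrite scale1r subrr.
elim: m => [|m IHm] mn k; first by rewrite leqn0 => /eqP->.
rewrite leq_eqVlt => /predU1P[->|]; last by rewrite ltnS; apply: IHm; apply: ltnW.
case: m IHm mn => [|m] IHm mn; first by rewrite /= mul1r.
have mn' : (m < n)%N by apply: ltnW.
apply: split_diag => [|c y]; last exact: twist_reduced.
have [ps ps1 psP] := weight_idempotents (IHm (ltnW mn)).
have [rs rsJ] : split_elt (J m).
  apply: (split_by_parts ps1) => p /psP[_ _ _ wp].
  have [a aE] := jm_weight mn' wp; exists [:: a].
  by rewrite /roots_poly big_seq1 horner_alg_XsubC mulrBl aE mulr_algl subrr.
apply: (split_by_parts ps1) => p /psP[_ _ _ wp].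
have [->|p0] := eqVneq p 0; first by exists [::]; rewrite mulr0.
have [a aE] := jm_weight mn' wp; have [chi [om [chiP omP]]] := wp.
have eE := idem_e_eigen H d_neq0 mn p0 (chiP m) (chiP m.+1).
have := jmS_killed H iota_inj mn rsJ aE eE.
rewrite /roots_poly -big_cat -/(roots_poly _) => killed.
eexists; rewrite twistS; apply: split_scaled killed; first exact: twist_jmC.
exact: omP.
Qed.

(** Each weight idempotent [p] turns the hypothesis into [(a - c) ^ 2] times [p * y] being zero,
    with [a] and [c] in a field. *)
Lemma jm_reduced m c y : (m < n)%N ->
  (J m - c%:A) * ((J m - c%:A) * y) = 0 -> (J m - c%:A) * y = 0.
Proof.
move=> mn yy; have [ps ps1 psP] := weight_idempotents (twist_diag mn).
rewrite -[LHS]mul1r -[X in X * _ = _]ps1 mulr_suml big_seq big1 // => p /psP[pp ap pC wp].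
have pJ : p * J m = J m * p.
  apply: pC => [j|k]; first exact: (t_jm H).
  rewrite leq_eqVlt => /predU1P[->|km]; first by rewrite twistS [RHS]mulrA -twist_jmC.
  by rewrite ltnS in km; rewrite (jm_comm H km) //; apply: twist_alg.
have [a aE] := jm_weight mn wp.
have pN z : p * ((J m - c%:A) * z) = (a - c) *: (p * z).
  by rewrite mulrA mulrBr pJ aE mulr_algr -scalerBl -scalerAl.
have := congr1 (fun z => p * z) yy; rewrite /= mulr0 !pN => /eqP.
by rewrite !scaler_eq0 orbA orbb -scaler_eq0 => /eqP.
Qed.

(** * The decomposition of [alg m.+2] as [alg m.+1] plus [alg m.+1 * g m * alg m.+1] *)

Definition dspan m v : Prop := forall P : B -> Prop,
  (forall x y, P x -> P y -> P (x + y)) -> (forall x, alg m.+1 x -> P x) ->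
  (forall x y, alg m.+1 x -> alg m.+1 y -> P (x * g m * y)) -> P v.

Lemma dspanD m u v : dspan m u -> dspan m v -> dspan m (u + v).
Proof. by move=> du dv P PD Px Pg; apply: (PD); [apply: du|apply: dv]. Qed.

Lemma dspan_alg m x : alg m.+1 x -> dspan m x.
Proof. by move=> ax P _ + _; apply. Qed.

Lemma dspan_g m x y : alg m.+1 x -> alg m.+1 y -> dspan m (x * g m * y).
Proof. by move=> ax ay P _ _; apply. Qed.

Lemma alg_g_swap m y : alg m y ->
  (exists2 y', alg m y' & y * g m = g m * y') /\
  (exists2 y', alg m y' & g m * y = y' * g m).
Proof.
have cP : subalg_closed_prop (fun y : B => (exists2 y', alg m y' & y * g m = g m * y') /\
  (exists2 y', alg m y' & g m * y = y' * g m)).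
  split=> [c|u v [[x1 a1 E1] [x2 a2 E2]] [[y1 b1 D1] [y2 b2 D2]]
           |u v [[x1 a1 E1] [x2 a2 E2]] [[y1 b1 D1] [y2 b2 D2]]]; split.
  - by exists c%:A; [apply: algC|rewrite mulr_algl mulr_algr].
  - by exists c%:A; [apply: algC|rewrite mulr_algl mulr_algr].
  - by exists (x1 + y1); [apply: algD|rewrite mulrDl mulrDr E1 D1].
  - by exists (x2 + y2); [apply: algD|rewrite mulrDl mulrDr E2 D2].
  - by exists (x1 * y1); [apply: algM|rewrite -mulrA D1 mulrA E1 mulrA].
  - by exists (x2 * y2); [apply: algM|rewrite mulrA E2 -mulrA D2 mulrA].
move=> ay; apply: (ay _ cP) => [j|i im].
  split; exists (t (swap_nat m j)); try exact: alg_t; first exact: (yh_swp H).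
  exact: (g_t H).
by split; exists (g i); [exact: alg_g|rewrite (yh_far H im)|exact: alg_g|rewrite (yh_far H im)].
Qed.

Lemma dspan_gyg m x y : (m.+1 < n)%N -> alg m.+1 x -> alg m y ->
  dspan m (x * g m * y * g m).
Proof.
move=> mn ax /alg_g_swap[[y' ay' E] _].
have {}ay' : alg m.+1 y' by apply: alg_mono ay'.
rewrite -mulrA E mulrA -(mulrA x) (yh_quad H mn) mulrDr mulrDl; apply: dspanD.
  by apply: dspan_alg; apply: algM => //; apply: algM => //; apply: algC.
rewrite -scalerAr -scalerAl mulrA scalerAl scalerAl; apply: dspan_g => //.
by apply: algZ; apply: algM => //; apply: alg_e.
Qed.

(** Multiplying on the right by generators of [alg m.+2], only [g m] after a term [x * g m * y] is
    not immediate. *)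
Lemma dspan_closed m : (forall x y, alg m.+1 x -> alg m.+1 y ->
    dspan m (x * g m * y * g m)) -> forall u, alg m.+2 u -> dspan m u.
Proof.
move=> key u au.
suff S v : dspan m v -> dspan m (v * u).
  by rewrite -[u]mul1r; apply: S; apply: dspan_alg; apply: alg1.
have W w : (forall x, alg m.+1 x -> dspan m (x * w)) ->
    (forall x y, alg m.+1 x -> alg m.+1 y -> dspan m (x * g m * y * w)) ->
    forall v, dspan m v -> dspan m (v * w).
  move=> W1 W2 z dz; apply: (dz (fun z => dspan m (z * w))) => // a b da db.
  by rewrite mulrDl; apply: dspanD.
have Wa w : alg m.+1 w -> forall v, dspan m v -> dspan m (v * w).
  move=> aw; apply: W => [x ax|x y ax ay]; first by apply: dspan_alg; apply: algM.
  by rewrite -mulrA; apply: dspan_g => //; apply: algM.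
move: v; apply: (au (fun w => forall v, dspan m v -> dspan m (v * w))).
- split=> [c|x y dx dy z dz|x y dx dy z dz]; first by apply: Wa; apply: algC.
    by rewrite mulrDr; apply: dspanD; [apply: dx|apply: dy].
  by rewrite mulrA; apply: dy; apply: dx.
- by move=> j; apply: Wa; apply: alg_t.
move=> i; rewrite ltnS leq_eqVlt => /predU1P[[->]|im]; last by apply: Wa; apply: alg_g.
apply: W => [x ax|]; last exact: key.
by rewrite -[_ * _]mulr1; apply: dspan_g => //; apply: alg1.
Qed.

Lemma alg_dspan m x : (m.+1 < n)%N -> alg m.+2 x -> dspan m x.
Proof.
elim: m x => [|m IHm] x mn; apply: dspan_closed => {}x y ax ay.
  (* [alg 1] and [alg 0] coincide, as neither has a generator [g]. *)
  by apply: dspan_gyg => // P cP Pt Pg; apply: ay.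
(* The middle factor is decomposed by induction: a [y] in [alg m.+1] slides past [g m.+1], and a
   product through [g m] is treated by the braid relation. *)
move: x ax; apply: (IHm y (ltnW mn) ay (fun y => forall x, alg m.+2 x ->
  dspan m.+1 (x * g m.+1 * y * g m.+1))) => {ay}y.
- move=> z dy dz x ax; rewrite mulrDr mulrDl; apply: dspanD; [exact: dy|exact: dz].
- by move=> ay x ax; exact: (dspan_gyg mn ax ay).
move=> z ay az x ax.
have [_ [y' ay' E]] := alg_g_swap ay; have [[z' az' E'] _] := alg_g_swap az.
have -> : x * g m.+1 * (y * g m * z) * g m.+1 = x * y' * g m * g m.+1 * (g m * z').
  rewrite -(mulrA x) !(mulrA (g m.+1)) E -!mulrA E' (mulrA (g m.+1) (g m)).
  by rewrite (mulrA (_ * g m)) -(yh_bra H) -!mulrA.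
have gm : alg m.+2 (g m) by apply: alg_g.
apply: dspan_g; last by apply: algM gm _; apply: alg_mono az'.
by apply: algM gm; apply: algM ax _; apply: alg_mono ay'.
Qed.

(** * Corners cut out by weight vectors *)

Lemma lwt_mono m m' chi om w : (m <= m')%N -> lwt m' chi om w -> lwt m chi om w.
Proof. by move=> mm [wt wL]; split=> // k km; apply: wL; apply: leq_trans mm. Qed.

Lemma rwt_mono m m' chi om w : (m <= m')%N -> rwt m' chi om w -> rwt m chi om w.
Proof. by move=> mm [wt wL]; split=> // k km; apply: wL; apply: leq_trans mm. Qed.

(** A second central element of [alg m]; it detects [g m] exchanging distinct eigenvalues of [t m]
    and [t m.+1]. *)
Let tprod m : B := \prod_(j < m) t j.

Lemma g_tprod_far i m : (m <= i)%N -> g i * tprod m = tprod m * g i.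
Proof.
rewrite /tprod; elim: m => [|m IHm] mi; first by rewrite big_ord0 mulr1 mul1r.
rewrite big_ord_recr /= mulrA IHm ?(ltnW mi) // -!mulrA (g_t H) swap_natD //; lia.
Qed.

Lemma tprod_comm m x : alg m x -> tprod m * x = x * tprod m.
Proof.
have tC k j : tprod k * t j = t j * tprod k.
  apply: (alg0_comm H); last exact: alg_t.
  rewrite /tprod; elim/big_ind: _ => [|u v au av|l _]; [exact: alg1|exact: algM|exact: alg_t].
move=> ax; apply: (alg_commutes _ _ ax) => [//|i im].
have [k ->] : exists k, m = (i.+2 + k)%N by exists (m - i.+2)%N; lia.
elim: k => [|k IHk]; last first.
  rewrite /tprod addnS big_ord_recr /= -/(tprod _) -mulrA (yh_swp H) swap_natD; [|lia..].
  by rewrite mulrA IHk mulrA.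
have E : t i * t i.+1 * g i = g i * (t i * t i.+1).
  rewrite -mulrA (yh_swp H) swap_natr mulrA (yh_swp H) swap_natl -mulrA.
  by rewrite (yh_com H i.+1).
rewrite addn0 /tprod !big_ord_recr /= -/(tprod _) -(mulrA (tprod i)) -(mulrA _ _ (g i)) E.
by rewrite !(mulrA _ (g i)) (mulrA (g i) (tprod i)) g_tprod_far.
Qed.

Lemma tprod_lwt m chi w : (forall j, t j * w = chi j *: w) ->
  tprod m * w = (\prod_(j < m) chi j) *: w.
Proof.
move=> tw; rewrite /tprod; elim: m => [|m IHm]; first by rewrite !big_ord0 mul1r scale1r.
by rewrite !big_ord_recr /= -mulrA tw -scalerAr IHm scalerA mulrC.
Qed.

Lemma tprod_rwt m chi w : (forall j, w * t j = chi j *: w) ->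
  w * tprod m = (\prod_(j < m) chi j) *: w.
Proof.
move=> tw; rewrite /tprod; elim: m => [|m IHm]; first by rewrite !big_ord0 mulr1 scale1r.
by rewrite !big_ord_recr /= mulrA IHm -scalerAl tw scalerA.
Qed.

(* [g w] is a combination of [w] and of a vector on which the central element
   [twist m.+1], or [tprod m.+1] if [t m] and [t m.+1] act differently on [w], takes
   another value than on [p']; the latter vector is thus killed by [p' * x]. *)
Lemma weight_off_corner m chi om p' x w a b : (m.+1 < n)%N ->
  rwt m.+1 chi om p' -> alg m.+1 x -> w != 0 -> lwt m a b w ->
  L m.+1 * w = om m.+1 *: w -> L m.+2 * w = om m.+2 *: w ->
  tprod m.+1 * w = (\prod_(j < m.+1) chi j) *: w ->
  exists c, p' * x * g m * w = c *: (p' * x * w).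
Proof.
move=> mn [p't p'L] ax w0 [wt wL] L1w L2w tw.
have mn' := ltnW mn.
have [bm0 Jw] := jm_eigen (ltnW mn') w0 (wL m (leqnn m)) L1w.
have [om0 J'w] := jm_eigen mn' w0 L1w L2w.
set a1 := _ / _ in Jw; set c1 := _ / _ in J'w.
have a1E : om m.+1 = b m * a1 by rewrite /a1 mulrC divfK.
have [am|am] := eqVneq (a m) (a m.+1); last first.
  exists 0; rewrite scale0r.
  have gT : tprod m.+1 * (g m * w) = ((\prod_(j < m) a j) * a m.+1) *: (g m * w).
    rewrite /tprod big_ord_recr /= -/(tprod m) -!mulrA (mulrA (t m)) (yh_swp H) swap_natl.
    rewrite -(mulrA (g m)) wt -!scalerAr mulrA -g_tprod_far // -mulrA (tprod_lwt m wt).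
    by rewrite -scalerAr scalerA mulrC.
  have th0 : \prod_(j < m) a j != 0.
    apply/prodf_neq0 => j _; apply/eqP => aj0.
    have := t_eigen_ord H w0 (wt j); rewrite aj0 expr0n eqn0Ngt d_gt0 => /eqP.
    by rewrite eq_sym oner_eq0.
  have chiE : \prod_(j < m.+1) chi j = (\prod_(j < m) a j) * a m.
    have := tprod_lwt m.+1 wt; rewrite tw => /eqP.
    rewrite -subr_eq0 -scalerBl scaler_eq0 (negPf w0) orbF subr_eq0 => /eqP->.
    by rewrite big_ord_recr.
  have : p' * tprod m.+1 * x * (g m * w) = p' * x * (tprod m.+1 * (g m * w)).
    by rewrite -(mulrA p') (tprod_comm ax) !mulrA.
  rewrite gT (tprod_rwt _ p't) chiE -!scalerAl -scalerAr !mulrA => /eqP.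
  rewrite -subr_eq0 -scalerBl scaler_eq0 -mulrBr mulf_eq0 (negPf th0) subr_eq0 (negPf am).
  by move=> /eqP.
have ew : e m * w = w.
  by rewrite (idem_e_eigen H d_neq0 mn w0 (wt m) (wt m.+1)) am eqxx scale1r.
(* Equal eigenvalues of [jm m] and [jm m.+1] are excluded by [jmS_neq], the eigenvalue being
   nonzero. *)
have ac : a1 - c1 != 0.
  apply/eqP => /eqP; rewrite subr_eq0 => /eqP ac; rewrite -ac in J'w.
  have := jmS_neq H iota_inj mn (fun c y => @jm_reduced m.+1 c y mn) Jw J'w ew.
  move/eqP; rewrite scaler_eq0 (negPf w0) orbF => /eqP a10.
  by move: om0; rewrite a1E a10 mulr0 eqxx.
have tauw : tau iota g m * w = (a1 - c1) *: (g m * w) + ((q - 1) * c1) *: w.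
  rewrite (tauE H iota_inj mn) mulrDl -mulrA mulrBl Jw J'w -scalerBl -scalerAr.
  by rewrite -mulrA J'w -!scalerAr -scalerAl ew scalerA mulrC.
have Ltau : L m.+1 * (tau iota g m * w) = (b m * c1) *: (tau iota g m * w).
  rewrite twistS -mulrA (mulrA (J m)) (jm_tau H iota_inj mn) -mulrA J'w -!scalerAr.
  rewrite mulrA.
  have -> : L m * tau iota g m = tau iota g m * L m.
    rewrite /tau mulrBr mulrBl !mulrA; congr (_ - _).
      by rewrite -(g_twist_far H) // -!mulrA twist_jmC.
    by rewrite twist_jmC -!mulrA -(g_twist_far H).
  by rewrite -mulrA wL // -scalerAr scalerA mulrC.
have ptau : p' * x * (tau iota g m * w) = 0.
  have : p' * L m.+1 * x * (tau iota g m * w) = p' * x * (L m.+1 * (tau iota g m * w)).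
    by rewrite -(mulrA p') (twist_comm H iota_inj ax) !mulrA.
  rewrite Ltau p'L // -!scalerAl -scalerAr a1E => /eqP.
  rewrite -subr_eq0 -scalerBl scaler_eq0 -mulrBr mulf_eq0 (negPf bm0) (negPf ac).
  by move/eqP.
(* Obtained by solving [p' * x * (tau * w) = 0] for the term in [g m * w]. *)
exists (- ((a1 - c1)^-1 * ((q - 1) * c1))).
apply: (scalerI ac); rewrite scalerA mulrN mulrA divff // mul1r.
move: ptau; rewrite tauw mulrDr -!scalerAr !mulrA => /eqP.
by rewrite addr_eq0 scaleNr => /eqP.
Qed.

(** In a term [x * g m * y], the identity is inserted after [g m] as a sum of weight idempotents
    [r]. Then [weight_off_corner] removes [g m] in front of [r * y * p], and [x * (r * y)] falls
    under the induction hypothesis. *)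
Lemma weight_corner m : (m < n)%N -> forall chi om p p' b,
  lwt m.+1 chi om p -> rwt m.+1 chi om p' -> alg m.+1 b ->
  exists c, p' * b * p = c *: (p' * p).
Proof.
elim: m => [|m IHm] mn chi om p p' b pP p'P ab.
  have [c E] : exists c, b * p = c *: p; last by exists c; rewrite -mulrA E -scalerAr.
  apply: (ab (fun b => exists c, b * p = c *: p)) => //.
    split=> [c|x y [c E] [c' E']|x y [c E] [c' E']].
    - by exists c; rewrite mulr_algl.
    - by exists (c + c'); rewrite mulrDl E E' scalerDl.
    - by exists (c * c'); rewrite -mulrA E' -scalerAr E scalerA mulrC.
  by move=> j; exists (chi j); case: pP => ->.
have mn' := ltnW mn.
have pP' := lwt_mono (leqnSn _) pP; have p'P' := rwt_mono (leqnSn _) p'P.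
have sumP u v : (exists c, p' * u * p = c *: (p' * p)) ->
    (exists c, p' * v * p = c *: (p' * p)) -> exists c, p' * (u + v) * p = c *: (p' * p).
  by move=> [c E] [c' E']; exists (c + c'); rewrite mulrDr mulrDl E E' scalerDl.
refine (alg_dspan mn ab (P := fun b : B => exists c : K, p' * b * p = c *: (p' * p)) _ _ _) =>
  // [x ax|x y ax ay]; first exact: IHm mn' _ _ _ _ _ pP' p'P' ax.
have [ps ps1 psP] := weight_idempotents (twist_diag mn').
rewrite -[y]mul1r -ps1 mulr_suml mulr_sumr big_seq.
elim/big_ind: _ => [||r /psP[_ ar _ [a [om' rP]]]]; first 2 last.
  set w := r * y * p.
  have [w0|w0] := eqVneq w 0.
    by exists 0; rewrite scale0r -[RHS](mulr0 (p' * (x * g m))) -w0 /w !mulrA.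
  have ary : alg m.+1 (r * y) by apply: algM.
  (* [w] has the weights of [r] up to level [m], and those of [p] at levels [m.+1] and [m.+2], where
     [twist] commutes with [r * y]. *)
  have Lw k : (m < k <= m.+2)%N -> L k * w = om k *: w.
    move=> /andP[mk km]; case: (pP) => _ pL.
    rewrite /w mulrA (twist_comm H iota_inj (m := k)); last exact: alg_mono ary.
    by rewrite -mulrA pL // -scalerAr.
  have wP : lwt m a om' w.
    case: rP => rt rL; split=> [j|k km]; rewrite /w !mulrA ?rt ?rL -?scalerAl //.
    exact: ltnW.
  have tw : tprod m.+1 * w = (\prod_(j < m.+1) chi j) *: w.
    rewrite /w mulrA (tprod_comm ary) -mulrA (tprod_lwt m.+1 (chi := chi)) -?scalerAr //.
    by case: pP.
  have L1w : L m.+1 * w = om m.+1 *: w by apply: Lw; lia.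
  have L2w : L m.+2 * w = om m.+2 *: w by apply: Lw; lia.
  have [c E] := weight_off_corner mn p'P' ax w0 wP L1w L2w tw.
  have [|c' E'] := IHm mn' _ _ _ _ (x * (r * y)) pP' p'P'; first exact: algM.
  exists (c * c'); rewrite -scalerA -E' /w in E *.
  by rewrite !mulrA in E *; rewrite E.
- by exists 0; rewrite mulr0 mul0r scale0r.
- exact: sumP.
Qed.

End Weights.

(** * Semisimplicity and splitting for a system of generators *)

Section SplitSemisimplicity.
Variables (F K : fieldType) (iota : {rmorphism {poly F} -> K}) (B : algType K).
Variables (d n : nat) (g t : nat -> B).
Hypothesis H : yh_system iota d n g t.
Hypothesis iota_inj : injective iota.
Hypothesis natF_neq0 : forall m, m.+1%:R != 0 :> F.
Hypothesis d_gt0 : (0 < d)%N.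
Hypothesis n_gt0 : (0 < n)%N.
Hypothesis unity_roots : exists2 rs : seq K, uniq rs & 'X^d - 1 = roots_poly rs.

Let n1_lt : (n.-1 < n)%N. Proof. by rewrite prednK. Qed.

Let alg_full x : alg g t n.-1.+1 x.
Proof. by rewrite prednK //; apply: (alg_all H). Qed.

Lemma yh_system_semisimple : semisimple_ring B.
Proof.
move=> S [S0 SD].
have [||f [lf fS fC fE]] := @maschke_projection _ _ _ _ _ _ _ _ H d_gt0 n_gt0 n.-1
   (fun y : B => y \in S) n1_lt.
- split=> // c u v Su Sv; rewrite -mulr_algl; exact: SD.
- by move=> x y _ Sy; rewrite -[x * y]addr0; apply: SD.
have [z zc] := casimir_linv H iota_inj natF_neq0 d_gt0 n_gt0 n1_lt.
have fM x y : f (x * y) = x * f y by apply: fC; apply: alg_full.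
have fD u v : f (u + v) = f u + f v by have := lf 1 u v; rewrite !scale1r.
have fN u : f (- u) = - f u by rewrite -mulN1r fM mulN1r.
have f0 : f 0 = 0 by rewrite -[0](mul0r 0) fM !mul0r.
(* The complement is the kernel of [f]; [z * f v] is the component in [S] because [f] acts there by
   [casimir], whose left inverse is [z]. *)
pose T : {pred B^o} := fun y : B => f y == 0.
have TP y : reflect (f y = 0) (y \in T) by apply: eqP.
exists T; split=> [|v Sv /TP fv|v].
- split=> [|a u v /TP fu /TP fv]; apply/TP; first exact: f0.
  by rewrite -[f _]/(f ((a : B) * u + v)) fD fM fu fv mulr0 addr0.
- by rewrite -[v]mul1r -zc -mulrA -fE // fv mulr0.
exists (z * f v), (v - z * f v); split; last by rewrite addrC subrK.
  by rewrite -[_ * _]addr0; apply: SD.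
by apply/TP; rewrite fD fN fM (fE (f v)) // mulrA zc mul1r subrr.
Qed.

Lemma yh_system_split : split_algebra B.
Proof.
move=> V [[v0 v0_neq0] V_simple] f.
have [ps ps1 psP] := weight_idempotents H iota_inj unity_roots
  (twist_diag H iota_inj natF_neq0 d_gt0 n_gt0 unity_roots (leqnn n)).
have [p ps_p pv0] : exists2 p, p \in ps & p *: v0 != 0.
  apply: contrapT => no; case/eqP: v0_neq0.
  rewrite -[v0]scale1r -ps1 scaler_suml big_seq big1 // => p ps_p.
  by apply: contrapT => pv0; apply: no; exists p => //; apply/eqP.
have [pp _ pC [chi [om pL]]] := psP p ps_p.
have pR : rwt iota g t n chi om p.
  case: (pL) => pt pLk; split=> [j|k kn].
    by rewrite pC ?pt // => [i|k _]; [exact: (yh_com H)|rewrite (t_twist H)].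
  rewrite pC ?pLk // => [i|l _]; [exact: (t_twist H)|exact: (twist_twistC H)].
(* By simplicity, the nonzero vector [p *: v0] generates [V]. *)
have orbit (u : V) : exists b : B, u = b *: (p *: v0).
  have [|Z|Z] := V_simple (fun u => `[< exists b : B, u = b *: (p *: v0) >]).
  - split=> [|a x y /asboolP[b ->] /asboolP[c ->]]; apply/asboolP.
      by exists 0; rewrite scale0r.
    by exists (a * b + c); rewrite scalerDl -(scalerA a).
  - by case/eqP: pv0; apply: Z; apply/asboolP; exists 1; rewrite scale1r.
  - exact/asboolP/Z.
have [b fv0] := orbit (f v0).
have [c cE] : exists c, p * b * p = c *: (p * p).
  rewrite -[n](prednK n_gt0) in pL pR.
  exact: (weight_corner H iota_inj natF_neq0 d_gt0 n_gt0 unity_roots n1_lt pL pR).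
(* The vectors on which [f] acts by [c] form a submodule. It contains [p *: v0], since [f (p *: v0)]
   is [p * b * p] applied to [v0]. *)
exists c => v; pose S u := f u == c%:A *: u.
have [|Z|Z] := V_simple S.
- split=> [|a x y /eqP fx /eqP fy]; apply/eqP; first by rewrite linear0 scaler0.
  rewrite linearP fx fy scalerDr !scalerA; congr (_ *: _ + _).
  by rewrite mulr_algl mulr_algr.
- case/eqP: pv0; apply: Z; apply/eqP.
  by rewrite linearZ /= fv0 !scalerA mulrA cE pp -[c *: p]mulr_algl.
- exact/eqP/Z.
Qed.

End SplitSemisimplicity.

(** * The Yokonuma-Hecke algebra *)

Lemma free_alg_ind (A : comNzRingType) (X : choiceType) (P : free_alg A X -> Prop) :
  P 1 -> (forall x y, P x -> P y -> P (x + y)) -> (forall x y, P x -> P y -> P (x * y)) ->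
  (forall c x, P x -> P (c *: x)) -> (forall x, P (gen A x)) -> forall u, P u.
Proof.
move: P; rewrite /gen /free_alg; case: free_key => P P1 PD PM PZ Pg u.
have Pm (m : {fmonom X}) : P << m >>.
  rewrite -[m]fmK; elim: (fmonom_val m) => [|x s IHs].
    by have -> : FMonom [::] = mone :> {fmonom X} by apply/eqP; rewrite fmP fm1.
  have -> : FMonom (x :: s) = mmul (fmu x) (FMonom s) by apply/eqP; rewrite fmP fmM fmU.
  have -> : << mmul (fmu x) (FMonom s) >> = << fmu x >> * << FMonom s >> :> {malg A[{fmonom X}]}.
    by rewrite malgM_def fgmulUU mulr1.
  exact: PM.
rewrite (monalgE u); elim/big_ind: _ => [|//|m _].
  by rewrite -[0](scale0r 1); apply: PZ.
have -> : << u@_m *g m >> = u@_m *: (<< m >> : {malg A[{fmonom X}]}).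
  by apply/malgP => k; rewrite mcoeffZ !mcoeffU mulr_natr.
exact: PZ.
Qed.

(** * Roots of unity in C(q) *)

Section UnityRoots.
Variable R : realType.

(** Over the algebraically closed constants ['X^d - 1] splits, with distinct roots by separability;
    the factorization is mapped to C(q). *)
Lemma ratfun_unity_roots d : (0 < d)%N ->
  exists2 rs : seq (ratfun R), uniq rs & 'X^d - 1 = roots_poly rs.
Proof.
move=> d_gt0.
have [rs rsE] := closed_field_poly_normal ('X^d - 1 : {poly R[i]}).
have lc : lead_coef ('X^d - 1 : {poly R[i]}) = 1.
  by rewrite -polyC1; apply/monicP/monicXnsubC.
rewrite lc scale1r in rsE.
have urs : uniq rs.
  rewrite -separable_prod_XsubC -rsE separable_Xn_sub_1 //.
  by rewrite Num.Theory.pnatr_eq0 -lt0n.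
pose h : {rmorphism R[i] -> ratfun R} := poly_ratfun R \o polyC.
exists (map h rs); first by rewrite map_inj_uniq //; apply: fmorph_inj.
have := congr1 (map_poly h) rsE; rewrite rmorphB /= map_polyXn rmorph1 => ->.
rewrite rmorph_prod /roots_poly big_map; apply: eq_bigr => r _.
by rewrite rmorphB /= map_polyX map_polyC.
Qed.

End UnityRoots.

(** * The concrete algebra as a system of generators *)

Section Concrete.
Variables (R : realType) (d n : nat) (d_gt0 : (0 < d)%N).

Local Notation A := (laurent R).
Local Notation rho := (laurent_incl R).
Local Notation Y := (yokonuma_hecke R d n d_gt0).
Local Notation B := (yokonuma_hecke_q R d n d_gt0).
Local Notation YF := (yh_free R n).

Definition yh_pr (x : YF) : Y := pr (ideal_gen (yh_rel d (@free_g R n) (@free_t R n))) x.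

Lemma yh_pr1 : yh_pr 1 = 1. Proof. by []. Qed.
Lemma yh_prD x y : yh_pr (x + y) = yh_pr x + yh_pr y. Proof. exact: prD. Qed.
Lemma yh_prM x y : yh_pr (x * y) = yh_pr x * yh_pr y. Proof. exact: prM. Qed.
Lemma yh_prZ c x : yh_pr (c *: x) = c *: yh_pr x. Proof. exact: prZ. Qed.

Lemma yh_pr_rel x y : yh_rel d (@free_g R n) (@free_t R n) x y -> yh_pr x = yh_pr y.
Proof.
move=> xy; apply/prP/zspan_gen; exists 1, x, y, 1; split=> //.
by rewrite mul1r mulr1.
Qed.

Definition yh_tens (k : ratfun R) (y : Y) : B := tens rho k y.

Lemma yh_tensDr k y y' : yh_tens k (y + y') = yh_tens k y + yh_tens k y'.
Proof. exact: tensDr. Qed.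
Lemma yh_tensM k k' y y' : yh_tens k y * yh_tens k' y' = yh_tens (k * k') (y * y').
Proof. exact: tensor_mulE. Qed.
Lemma yh_tensZ c k y : c *: yh_tens k y = yh_tens (c * k) y.
Proof. exact: tensor_scaleE. Qed.
Lemma yh_tens1 : yh_tens 1 1 = 1. Proof. by []. Qed.
Lemma yh_tens_bal k a y : yh_tens (k * rho a) y = yh_tens k (a *: y).
Proof. exact: tens_bal. Qed.

(** A ring morphism semilinear along [rho], through which the defining relations of the free algebra
    reach the scalar extension. *)
Definition phi (x : YF) : B := yh_tens 1 (yh_pr x).

Lemma phi1 : phi 1 = 1. Proof. by rewrite /phi yh_pr1 yh_tens1. Qed.
Lemma phiD x y : phi (x + y) = phi x + phi y.
Proof. by rewrite /phi yh_prD yh_tensDr. Qed.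
Lemma phiM x y : phi (x * y) = phi x * phi y.
Proof. by rewrite /phi yh_prM yh_tensM mulr1. Qed.
Lemma phiZ c x : phi (c *: x) = rho c *: phi x.
Proof. by rewrite /phi yh_prZ -yh_tens_bal yh_tensZ mul1r mulr1. Qed.
Lemma phi_rel x y : yh_rel d (@free_g R n) (@free_t R n) x y -> phi x = phi y.
Proof. by move=> xy; rewrite /phi (yh_pr_rel xy). Qed.
Lemma phi0 : phi 0 = 0.
Proof. by rewrite -(scale0r (0 : YF)) phiZ rmorph0 scale0r. Qed.
Lemma phiX x k : phi (x ^+ k) = phi x ^+ k.
Proof. by elim: k => [|k IHk]; rewrite ?expr0 ?phi1 // !exprS phiM IHk. Qed.
Lemma phi_sum (I : Type) (r : seq I) (E : I -> YF) :
  phi (\sum_(i <- r) E i) = \sum_(i <- r) phi (E i).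
Proof.
by elim: r => [|i r IHr]; rewrite ?big_nil ?phi0 // !big_cons phiD IHr.
Qed.

Definition gen_g (i : nat) : B :=
  if insub i is Some i' then phi (@free_g R n i') else 0.
Definition gen_t (j : nat) : B :=
  if insub j is Some j' then phi (@free_t R n j') else 1.

Lemma gen_gE (i : 'I_n.-1) : gen_g i = phi (free_g R i).
Proof. by rewrite /gen_g valK. Qed.
Lemma gen_tE (j : 'I_n) : gen_t j = phi (free_t R j).
Proof. by rewrite /gen_t valK. Qed.

Variant gen_g_spec (i : nat) : B -> Prop :=
| GenGIn (i' : 'I_n.-1) of i = i' :> nat : gen_g_spec i (phi (free_g R i'))
| GenGOut of (n.-1 <= i)%N : gen_g_spec i 0.

Lemma gen_gP i : gen_g_spec i (gen_g i).
Proof.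
rewrite /gen_g; case: insubP => [i' _ <-|]; first exact: GenGIn.
by rewrite -leqNgt => /GenGOut.
Qed.

Lemma gen_span (P : B -> Prop) : subalg_closed_prop P ->
  (forall j, P (gen_t j)) -> (forall i, (i.+1 < n)%N -> P (gen_g i)) -> forall x, P x.
Proof.
move=> [PC PD PM] Pt Pg x.
have PZ c y : P y -> P (c *: y) by move=> Py; rewrite -mulr_algl; apply: PM.
have Pphi u : P (phi u).
  apply: (free_alg_ind (P := fun u => P (phi u))) => [|v w Pv Pw|v w Pv Pw|c v Pv|[i|j]].
  - by rewrite phi1 -[1]scale1r.
  - by rewrite phiD; apply: PD.
  - by rewrite phiM; apply: PM.
  - by rewrite phiZ; apply: PZ.
  - rewrite -[gen _ _]/(free_g R i) -gen_gE; apply: Pg.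
    by have := ltn_ord i; lia.
  - by rewrite -[gen _ _]/(free_t R j) -gen_tE; apply: Pt.
elim/tensor_ind: x => [k y|u v Pu Pv].
  rewrite -[y](rpK (S := ideal_gen (yh_rel d (@free_g R n) (@free_t R n)))).
  rewrite -[tens _ _ _]/(yh_tens k (yh_pr (rp y))) -[k]mulr1 -yh_tensZ.
  exact/PZ/Pphi.
by rewrite -[u - v]/((u : B) - (v : B)) -scaleN1r; apply: PD => //; apply: PZ.
Qed.

Lemma gen_e (i : 'I_n.-1) :
  phi (yh_e d (@free_t R n) i) = idem_e (poly_ratfun R) d gen_t i.
Proof.
rewrite /yh_e /idem_e phiZ phi_sum; congr (_ *: _); apply: eq_bigr => s _.
by rewrite phiM !phiX -!gen_tE.
Qed.

Lemma yokonuma_hecke_q_system : yh_system (poly_ratfun R) d n gen_g gen_t.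
Proof.
split.
- move=> i j ij; case: (gen_gP i) => [i' iE|_]; last by rewrite mul0r mulr0.
  case: (gen_gP j) => [j' jE|_]; last by rewrite mul0r mulr0.
  by rewrite -!phiM; apply: phi_rel; apply: yh_gg; rewrite -iE -jE ij.
- move=> i; case: (gen_gP i) => [i' iE|io]; last by rewrite !(mul0r, mulr0).
  case: (gen_gP i.+1) => [j' jE|_]; last by rewrite !(mul0r, mulr0).
  by rewrite -!phiM; apply: phi_rel; apply: yh_braid; rewrite -iE -jE.
- move=> i j; rewrite /gen_t; case: insubP => [i' _ _|_]; last by rewrite mul1r mulr1.
  case: insubP => [j' _ _|_]; last by rewrite mul1r mulr1.
  by rewrite -!phiM; apply: phi_rel; apply: yh_tt.
- move=> i j; case: (gen_gP i) => [i' ->|_]; last by rewrite mul0r mulr0.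
  have i1 := ltn_ord i'.
  rewrite {1}/gen_t; case: insubP => [j' _ <-|]; last first.
    (* For [j] out of range both [t] are 1, as the transposition of [i'] and [i'.+1] stays below [n]
       and fixes [j]. *)
    rewrite -leqNgt => nj; rewrite swap_natD; [|lia..].
    by rewrite /gen_t insubN ?mul1r ?mulr1 // -leqNgt.
  have -> : swap_nat i' j' = tperm (ord_cur i') (ord_next i') j' :> nat.
    rewrite /swap_nat; case: tpermP => [->|->|/eqP + /eqP].
    + by rewrite eqxx.
    + by rewrite /= eqxx; case: eqP => //; lia.
    + by rewrite -!val_eqE /= => /negPf-> /negPf->.
  by rewrite gen_tE -!phiM; apply: phi_rel; apply: yh_tg.
- move=> j; rewrite /gen_t; case: insubP => [j' _ _|_]; last by rewrite expr1n.
  by rewrite -phiX -phi1; apply: phi_rel; apply: yh_td.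
- move=> i i_lt; have i_lt' : (i < n.-1)%N by lia.
  have gE : gen_g i = phi (free_g R (Ordinal i_lt')) by exact: (gen_gE (Ordinal i_lt')).
  rewrite gE -phiM -expr2 (phi_rel (yh_gquad d _ _ _)) phiD !phiZ phi1 phiM gen_e.
  by rewrite rmorphB rmorph1.
- by move=> j nj; rewrite /gen_t insubN // -leqNgt.
- exact: gen_span.
Qed.

End Concrete.

Theorem corollary3p8 (R : realType) (d n : nat)
    (d_gt0 : (0 < d)%N) (n_gt0 : (0 < n)%N) :
  split_semisimple (yokonuma_hecke_q R d n d_gt0).
Proof.
have H := yokonuma_hecke_q_system R n d_gt0.
have natF m : m.+1%:R != 0 :> R[i] by rewrite Num.Theory.pnatr_eq0.
have inj : injective (poly_ratfun R) by move=> p r /eqP; rewrite tofrac_eq => /eqP.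
have roots := ratfun_unity_roots R d_gt0.
split; first exact: (yh_system_semisimple H inj natF d_gt0 n_gt0).
exact: (yh_system_split H inj natF d_gt0 n_gt0 roots).
Qed.
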